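(* The complexity of (1,2)Insertion is at most $n \lg n - 1.40118n$.
   Context: Complexity means the expected number of comparisons over all $n!$ orderings of $n$ distinct input elements (uniformly random input); $n$ is assumed even and $O(\log n)$ terms are ignored. Notation: $\lg=\log_2$, and for real $x>0$, $p_x = x/2^{\lceil \lg x\rceil}\in(1/2,1]$. RHBS$(A,T)$ (right-heavy binary search) inserts $A$ into a sorted $T=(t_1,\dots,t_i)$: if $i\le 3\cdot 2^{\lceil\lg(i+1)\rceil-2}-1$ let $d=2^{\lceil\lg(i+1)\rceil-2}$, otherwise $d=i-2^{\lceil\lg(i+1)\rceil-1}+1$; compare $A$ with $t_d$ and recurse into $(t_1,\dots,t_{d-1})$ or $(t_{d+1},\dots,t_i)$. 2Merge$(A,B,T)$ with $T=(t_1,\dots,t_{i-2})$ sorted, $i$ even, $i\ge4$: Step 1 compare $A,B$ and swap so that $A<B$. Step 2: with $\alpha(r)=1-2^{-r/2}$, for $r=1,2,\dots$ up to $2\lg i$ compare $A$ with $t_{\lceil\alpha(r)i\rceil}$ and stop at the first $r$ with $A<t_{\lceil\alpha(r)i\rceil}$. Step 3: insert $A$ into $(t_{\lceil\alpha(r-1)i\rceil+1},\dots,t_{\lceil\alpha(r)i\rceil-1})$ by RHBS; say $A$ falls between $t_\ell$ and $t_{\ell+1}$. Step 4: insert $B$ into $(t_{\ell+1},\dots,t_{i-2})$ by RHBS. (1,2)Insertion$(S)$, $S=(s_1,\dots,s_n)$, $n$ even: if $n=2$ sort with one comparison; otherwise sort $(s_1,\dots,s_{n-2})$ recursively by (1,2)Insertion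 to get $T'$; if $p_n\in[0.5511,0.888]$ insert $s_{n-1},s_n$ into $T'$ by 2Merge$(s_{n-1},s_n,T')$, otherwise insert $s_{n-1}$ by RHBS and then $s_n$ by RHBS. *)

(* Defs.v *)
From mathcomp Require Import all_boot all_order all_algebra all_fingroup.
From mathcomp Require Import reals exp.

Set Implicit Arguments.
Unset Strict Implicit.
Unset Printing Implicit Defensive.

(* The algorithms are modelled as functions on sequences of distinct natural *)
(* numbers (elements compared with the usual order on nat).  Each function   *)
(* returns, together with its result, the number of comparisons made.        *)
(* Sequences are 0-indexed in Rocq; t_j of the paper is  nth 0 T j.-1.      *)

Definition ins_at (p x : nat) (s : seq nat) : seq nat :=
  take p s ++ x :: drop p s.

(* Choice of the pivot index d (1-based) of RHBS for a sorted T of size i >= 1: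
   with k = ceil(lg (i+1)) = up_log 2 i.+1,
   d = 2^(k-2)          if i <= 3*2^(k-2) - 1,
   d = i - 2^(k-1) + 1  otherwise.
   (For i = 1, k = 1 and the first case does not apply, since 3*2^(-1)-1 < 1.) *)
Definition rhbs_pivot (i : nat) : nat :=
  let k := up_log 2 i.+1 in
  if (2 <= k) && (i <= 3 * 2 ^ (k - 2) - 1) then 2 ^ (k - 2)
  else i - 2 ^ (k - 1) + 1.

Fixpoint rhbs_aux (fuel a : nat) (T : seq nat) : nat * nat :=
  match fuel with
  | 0 => (0, 0)
  | fuel'.+1 =>
      if size T == 0 then (0, 0) else
      let d := rhbs_pivot (size T) in
      if a < nth 0 T d.-1 then
        let pc := rhbs_aux fuel' a (take d.-1 T) in (pc.1, pc.2.+1)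
      else
        let pc := rhbs_aux fuel' a (drop d T) in (d + pc.1, pc.2.+1)
  end.

Definition rhbs (a : nat) (T : seq nat) : nat * nat := rhbs_aux (size T) a T.

(* floor (i * 2^(-r/2)) : the largest q with q^2 * 2^r <= i^2 *)
Definition floor_scaled (i r : nat) : nat :=
  foldr maxn 0 [seq q <- iota 0 i.+1 | q ^ 2 * 2 ^ r <= i ^ 2].

(* ceil (alpha(r) * i) with alpha(r) = 1 - 2^(-r/2) *)
Definition alpha_idx (i r : nat) : nat := i - floor_scaled i r.

(* Step 2 of 2Merge.  T = (t_1..t_{i-2}); positions >= i-1 lie beyond T and
   are treated as +infinity (stop, no comparison).  Starting at round r with
   lower bound lo = ceil(alpha(r-1) i), returns (lo, hi, c): A lies strictly
   between t_lo and t_hi (hi = i-1 meaning "beyond t_{i-2}") and c is the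
   number of comparisons. *)
Fixpoint probe_aux (fuel : nat) (i a : nat) (T : seq nat) (r lo : nat)
  : nat * nat * nat :=
  match fuel with
  | 0 => (lo, i.-1, 0)
  | fuel'.+1 =>
      let j := alpha_idx i r in
      if i.-1 <= j then (lo, i.-1, 0)
      else if a < nth 0 T j.-1 then (lo, j, 1)
      else let res := probe_aux fuel' i a T r.+1 j in
           (res.1.1, res.1.2, res.2.+1)
  end.

Definition two_merge (A B : nat) (T : seq nat) : seq nat * nat :=
  let i := size T + 2 in
  let a := if A < B then A else B in
  let b := if A < B then B else A in
  let pr := probe_aux (2 * i).+1 i a T 1 0 in
  let lo := pr.1.1 in let hi := pr.1.2 in let c2 := pr.2 in
  let p3 := rhbs a (drop lo (take hi.-1 T)) in
  let l := lo + p3.1 in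
  let T1 := ins_at l a T in
  let p4 := rhbs b (drop l T) in
  (ins_at (l.+1 + p4.1) b T1, 1 + c2 + p3.2 + p4.2).

(* p_m in [0.5511, 0.888], with p_m = m / 2^(ceil(lg m)) *)
Definition use_2merge (m : nat) : bool :=
  let e := up_log 2 m in
  (5511 * 2 ^ e <= 10000 * m) && (1000 * m <= 888 * 2 ^ e).

Fixpoint ins12_aux (k : nat) (s : seq nat) : seq nat * nat :=
  match k with
  | 0 => ([::], 0)
  | 1 => let x := nth 0 s 0 in let y := nth 0 s 1 in
         (if x < y then [:: x; y] else [:: y; x], 1)
  | k'.+1 =>
      let Tc := ins12_aux k' s in
      let m := k.*2 in
      let x := nth 0 s (m - 2) in
      let y := nth 0 s (m - 1) in
      if use_2merge m then
        let res := two_merge x y Tc.1 in (res.1, Tc.2 + res.2)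
      else
        let p1 := rhbs x Tc.1 in
        let T1 := ins_at p1.1 x Tc.1 in
        let p2 := rhbs y T1 in
        (ins_at p2.1 y T1, Tc.2 + p1.2 + p2.2)
  end.

Definition ins12 (s : seq nat) : seq nat * nat := ins12_aux (size s)./2 s.

Definition ins12_cost (n : nat) (sigma : {perm 'I_n}) : nat :=
  (ins12 [seq val (sigma i) | i <- enum 'I_n]).2.

Local Open Scope ring_scope.

Definition ins12_complexity (R : realType) (n : nat) : R :=
  (\sum_(sigma : {perm 'I_n}) ins12_cost sigma)%N%:R / (n`!)%:R.

Definition lg (R : realType) (x : R) : R := ln x / ln 2.

(* Main.v *)
Require Import Defs.
From mathcomp Require Import all_boot all_order all_algebra all_fingroup.
From mathcomp Require Import functions reals topology normedtype derive realfun exp.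
From mathcomp Require Import zify ring lra.

(* Let F(m) be the expected number of comparisons for inserting the pair that brings the number
   of sorted elements to m. RHBS on L gaps is a tree with all leaves at depth k = ceil(lg L)
   except for the leftmost 2^k - L ones, at depth k - 1, so the cost of a step depends on ranks
   only, and the ranks are uniform by symmetry. Writing m = p 2^k with 1/2 < p <= 1, one gets
   F(m) <= 2 k + h(p) + O(1/m), where h(p) = 2 - 2/p for two single insertions and h is
   piecewise of the form a + b/p + d/p^2 for 2Merge: the segments of 2Merge shrink by the factor
   2^(-1/2), which makes the leading term of the cost self-similar. Summation over one octave
   becomes integration of h up to O(1) errors, so the complexity at n = p 2^k is k n - 2^k +
   2^(k-1) (H(1) + H(p)) + O(log n), with H the integral of h from 1/2. It remains to check that
   (H(1) + H(p)) / 2 <= 1 + p lg p - 1.40118 p on [1/2, 1], which is tight up to 3.5e-7. *)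

(** * Costs of RHBS and 2Merge in terms of ranks *)

(** The probed positions of 2Merge are rounded, so the segments are geometric only approximately.
    With an ideal length x remaining, rounding costs O(x) in the sum over pairs of ranks; these
    losses form a geometric series with sum O(m), so a pair of insertions is charged O(1 / m) after
    division by its m (m - 1) pairs of ranks, and the total stays O(log n). The passage from sum to
    integral is an induction with a potential function that contains the integral explicitly; the
    jumps of h are charged to a counter of breakpoints, which costs O(1) per octave. The irrational
    2^(-1/2) enters only as a number c with c^2 = 1/2 and a ten-digit enclosure. Because the final
    inequality is so tight, coefficients and logarithms are carried as nine-digit decimals. Its
    worst point lies above 0.888, where the pair is inserted singly; the range of 2Merge is reduced
    by monotonicity to 0.888 itself. *)

Definition rhbs_depth (s t : nat) : nat :=
  let k := up_log 2 s.+1 in k - (t < 2 ^ k - s.+1).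

Lemma up_log_itv k n : 2 ^ k < n.*2 -> n <= 2 ^ k -> up_log 2 n = k.
Proof.
case: k => [|k] lo hi; first by have -> : n = 1 by lia.
by apply: up_log_eq => //; rewrite hi andbT; move: lo; rewrite expnS; lia.
Qed.

Lemma up_log_le_itv n : 0 < n -> 2 ^ up_log 2 n < n.*2 /\ n <= 2 ^ up_log 2 n.
Proof.
case: n => // -[_|n _]; first by rewrite up_log1.
have /andP[lo hi] := up_log_bounds (isT : 1 < 2) (isT : 1 < n.+2).
split=> //; have : 0 < up_log 2 n.+2 by rewrite up_log_gt0.
by case: (up_log 2 n.+2) lo => //= k; rewrite expnS; lia.
Qed.

Lemma rhbs_depthE k s t : 2 ^ k < s.+1.*2 -> s.+1 <= 2 ^ k ->
  rhbs_depth s t = k - (t < 2 ^ k - s.+1).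
Proof. by move=> lo hi; rewrite /rhbs_depth (up_log_itv _ _ lo hi). Qed.

Lemma rhbs_pivot_bounds s : 0 < s -> 0 < rhbs_pivot s <= s.
Proof.
move=> s0; rewrite /rhbs_pivot.
have [] := up_log_le_itv s.+1 isT; set k := up_log 2 s.+1.
case: k => [|[|k]] /=; rewrite ?subn1 ?subSS ?subn0 /= ?expnS ?expn0; [lia|lia|].
have := expn_gt0 2 k; case: ifP => /=; lia.
Qed.

(** The pivot makes one subtree perfect: in the first case the left one, all of whose 2^(k-2) gaps
    are shallow, otherwise the right one, all of whose 2^(k-1) gaps are deep. The shallow leaves of
    the other subtree are again its leftmost ones. *)
Lemma rhbs_depth_rec s t : 0 < s -> t <= s ->
  rhbs_depth s t = (if t < rhbs_pivot s then rhbs_depth (rhbs_pivot s).-1 t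
                    else rhbs_depth (s - rhbs_pivot s) (t - rhbs_pivot s)).+1.
Proof.
move=> s0 ts; have [] := up_log_le_itv s.+1 isT.
rewrite /rhbs_pivot; set k := up_log 2 s.+1 => lo hi.
rewrite (rhbs_depthE k s) //.
case: k lo hi => [|[|k]] /=; rewrite ?subn1 ?subSS ?subn0 /=; [lia| |].
  rewrite !expnS expn0 => lo hi; have -> : s = 1 by lia.
  by rewrite subnn add0n; case: t ts => [|[|t]] //= _; rewrite /rhbs_depth up_log1.
have := expn_gt0 2 k; rewrite !expnS => /= k0 lo hi.
case: (leqP s (3 * 2 ^ k).-1) => C; case: ifP => A.
- rewrite (rhbs_depthE k); lia.
- rewrite (rhbs_depthE k.+1) ?expnS; lia.
- rewrite (rhbs_depthE k.+1) ?expnS; lia.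
- rewrite (rhbs_depthE k.+1) ?expnS; lia.
Qed.

Definition rank (a : nat) (T : seq nat) : nat := count (ltn^~ a) T.

Lemma ltn_nth_rank a T j : sorted ltn T -> j < size T ->
  (a <= nth 0 T j) = (rank a T <= j).
Proof.
rewrite /rank; elim: T j => //= x T IH j pT.
have sT := path_sorted pT.
have [xa|ax] := ltnP x a.
  case: j => [|j] /= jT; first lia.
  by rewrite IH // add1n.
have -> : count (ltn^~ a) T = 0.
  apply/eqP; rewrite -leqn0 leqNgt -has_count; apply/hasPn => y yT.
  have := order_path_min ltn_trans pT => /allP/(_ y yT) /=; lia.
case: j => [|j] /= jT; first lia.
have := order_path_min ltn_trans pT => /allP/(_ _ (mem_nth 0 (jT : j < size T))) /=; lia.
Qed.

Lemma rank_cat a s1 s2 : rank a (s1 ++ s2) = rank a s1 + rank a s2.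
Proof. exact: count_cat. Qed.

Lemma rank_le_size a T : rank a T <= size T.
Proof. exact: count_size. Qed.

Lemma sorted_rank_takeE a T j : sorted ltn T -> j <= size T ->
  rank a (take j T) = minn j (rank a T).
Proof.
rewrite /rank; elim: T j => [|x T IH] [|j] //= pT jT; first by rewrite min0n.
have /= IHj := IH j (path_sorted pT) jT; rewrite IHj.
have [xa|ax] := ltnP x a; first lia.
have -> : count (ltn^~ a) T = 0; last lia.
apply/eqP; rewrite -leqn0 leqNgt -has_count; apply/hasPn => y yT.
have := order_path_min ltn_trans pT => /allP/(_ y yT) /=; lia.
Qed.

Lemma sorted_rank_dropE a T j : sorted ltn T -> j <= size T ->
  rank a (drop j T) = rank a T - j.
Proof.
move=> sT jT; have := rank_cat a (take j T) (drop j T).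
rewrite cat_take_drop sorted_rank_takeE //; lia.
Qed.

Lemma lt_nth_rank (a : nat) T j : sorted ltn T -> a \notin T -> j < size T ->
  (a < nth 0 T j) = (rank a T <= j).
Proof.
move=> sT aT jT; rewrite -ltn_nth_rank // ltn_neqAle.
by case: eqVneq aT => // ->; rewrite mem_nth.
Qed.

Lemma rhbs_auxE f (a : nat) T : size T <= f -> sorted ltn T -> a \notin T ->
  rhbs_aux f a T = (rank a T, rhbs_depth (size T) (rank a T)).
Proof.
elim: f T => [|f IH] T Tf sT aT /=.
  by case: T Tf sT aT => //= _ _ _; rewrite /rhbs_depth up_log1.
have [T0|Tn0] := eqVneq (size T) 0.
  by case: T T0 {Tf sT aT} => //= _; rewrite /rhbs_depth up_log1.
have s0 : 0 < size T by lia.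
have /andP[d0 ds] := rhbs_pivot_bounds _ s0.
rewrite rhbs_depth_rec ?rank_le_size //.
set d := rhbs_pivot _ in d0 ds *.
rewrite lt_nth_rank //; last lia.
have -> : (rank a T <= d.-1) = (rank a T < d) by lia.
case: ifP => A.
  rewrite IH ?size_take //=; last 3 first.
  - by case: ifP; lia.
  - exact: take_sorted.
  - by apply: contra aT; apply: mem_take.
  rewrite sorted_rank_takeE //; last lia.
  have -> : minn d.-1 (rank a T) = rank a T by lia.
  by case: ifP => // B; have -> : size T = d.-1 by lia.
rewrite IH ?size_drop //=; last 3 first.
- lia.
- exact: drop_sorted.
- by apply: contra aT; apply: mem_drop.
rewrite sorted_rank_dropE // subnKC //; lia.
Qed.

Lemma rhbsE (a : nat) T : sorted ltn T -> a \notin T ->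
  rhbs a T = (rank a T, rhbs_depth (size T) (rank a T)).
Proof. exact: rhbs_auxE. Qed.

Lemma floor_scaledP i r :
  (floor_scaled i r) ^ 2 * 2 ^ r <= i ^ 2 < (floor_scaled i r).+1 ^ 2 * 2 ^ r.
Proof.
set P := fun q => q ^ 2 * 2 ^ r <= i ^ 2.
have maxP (s : seq nat) : (foldr maxn 0 s \in 0 :: s) /\
    forall q, q \in s -> q <= foldr maxn 0 s.
  elim: s => [|x s [IH1 IH2]] //=; split.
    rewrite /maxn; case: ifP => _; last by rewrite !inE eqxx orbT.
    by move: IH1; rewrite !inE => /orP[->|->] //; rewrite !orbT.
  move=> q; rewrite inE leq_max => /orP[/eqP->|/IH2->]; rewrite ?leqnn ?orbT //.
have [] := maxP [seq q <- iota 0 i.+1 | P q]; rewrite -/(floor_scaled i r) => Pin Pmax.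
apply/andP; split.
  move: Pin; rewrite inE mem_filter => /orP[/eqP->|/andP[]//].
  by rewrite exp0n.
rewrite ltnNge; apply/negP => Q.
have : (floor_scaled i r).+1 \in [seq q <- iota 0 i.+1 | P q].
  rewrite mem_filter mem_iota /P Q /= add0n ltnS -(leq_exp2r _ _ (isT : 0 < 2)).
  by apply: leq_trans Q; rewrite leq_pmulr // expn_gt0.
by move/Pmax; rewrite ltnn.
Qed.

Lemma floor_scaled_lt i r : 0 < i -> 0 < r -> floor_scaled i r < i.
Proof.
move=> i0 r0; rewrite -(ltn_exp2r _ _ (isT : 0 < 2)).
have /andP[+ _] := floor_scaledP i r.
case: (posnP (floor_scaled i r)) => [->|f0]; first by rewrite exp0n // expn_gt0 i0.
apply: leq_trans; rewrite -[X in X < _]muln1 ltn_pmul2l ?expn_gt0 ?f0 //.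
by rewrite -{1}(expn0 2) ltn_exp2l.
Qed.

Lemma alpha_idx_gt0 i r : 0 < i -> 0 < r -> 0 < alpha_idx i r.
Proof. by move=> i0 r0; rewrite subn_gt0 floor_scaled_lt. Qed.

(** Steps 2 and 3 of 2Merge fused into one count that depends only on the rank [l] of the smaller
    element; [lo] is the last position already known to lie below it. *)
Fixpoint probe_cost (fuel i r lo l : nat) : nat :=
  match fuel with
  | 0 => rhbs_depth (i.-2 - lo) (l - lo)
  | fuel'.+1 =>
      let j := alpha_idx i r in
      if i.-1 <= j then rhbs_depth (i.-2 - lo) (l - lo)
      else if l < j then (rhbs_depth (j.-1 - lo) (l - lo)).+1
      else (probe_cost fuel' i r.+1 j l).+1
  end.

Lemma probe_auxE f i (a : nat) T r lo : sorted ltn T -> a \notin T -> size T + 2 = i ->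
  0 < r -> lo <= rank a T ->
  let pr := probe_aux f i a T r lo in
  [/\ pr.1.1 <= rank a T <= pr.1.2.-1, pr.1.2.-1 <= size T &
    pr.2 + rhbs_depth (pr.1.2.-1 - pr.1.1) (rank a T - pr.1.1) =
    probe_cost f i r lo (rank a T)].
Proof.
move=> sT aT iE; have Ts := rank_le_size a T.
have stop lo' : lo' <= rank a T -> [/\ lo' <= rank a T <= i.-2, i.-2 <= size T &
    0 + rhbs_depth (i.-2 - lo') (rank a T - lo') =
    rhbs_depth (i.-2 - lo') (rank a T - lo')] by move=> lol; split=> //; lia.
elim: f r lo => [|f IH] r lo r0 lol /=; first exact: stop.
have j0 := alpha_idx_gt0 i r; case: ifP => B; first exact: stop.
rewrite lt_nth_rank //; last lia.
have -> : (rank a T <= (alpha_idx i r).-1) = (rank a T < alpha_idx i r) by lia.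
case: ifP => A /=; first by split; lia.
have [] := IH r.+1 (alpha_idx i r); [lia|lia|].
by move=> *; split=> //; lia.
Qed.

Lemma ins_at_sorted (x : nat) T : sorted ltn T -> x \notin T ->
  ins_at (rank x T) x T = sort leq (x :: T).
Proof.
move=> sT xT.
have perm : perm_eq (ins_at (rank x T) x T) (x :: T).
  by rewrite /ins_at perm_catC /= perm_cons perm_catC cat_take_drop.
apply: (sorted_eq leq_trans anti_leq) (sort_sorted leq_total _) _; last first.
  by rewrite perm_sym perm_sort perm_sym.
apply: (sub_sorted ltnW); rewrite /ins_at.
have rs := rank_le_size x T.
have tk (y : nat) : y \in take (rank x T) T -> y < x.
  move=> /(nthP 0)[i]; rewrite size_take => iT <-.
  have iT' : i < rank x T by case: ifP iT; lia.
  by rewrite nth_take // ltnNge ltn_nth_rank ?(leq_trans iT') // -ltnNge.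
have dp (y : nat) : y \in drop (rank x T) T -> x < y.
  move=> /(nthP 0)[i]; rewrite size_drop /= => iT <-.
  rewrite nth_drop lt_nth_rank //; lia.
have := sT; rewrite -{1}(cat_take_drop (rank x T) T).
rewrite !(sorted_pairwise ltn_trans) !pairwise_cat /= => /and3P[_ p1 p2].
apply/and3P; split; [|exact: p1|apply/andP; split; [|exact: p2]].
  apply/allrelP => y z /tk yx; rewrite inE => /orP[/eqP->//|/dp].
  by apply: ltn_trans.
by apply/allP => y /dp.
Qed.

Lemma sort_leq_ltn s : uniq s -> sorted ltn (sort leq s).
Proof. by move=> us; rewrite ltn_sorted_uniq_leq sort_uniq us sort_sorted //; apply: leq_total. Qed.

Lemma rank_perm (x : nat) s t : perm_eq s t -> rank x s = rank x t.
Proof. by move=> /seq.permP; apply. Qed.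

Lemma rank_mono x y T : x <= y -> rank x T <= rank y T.
Proof. by move=> xy; apply: sub_count => z /=; lia. Qed.


#[local] Arguments probe_cost : simpl never.
#[local] Arguments probe_aux : simpl never.
#[local] Arguments use_2merge : simpl never.
#[local] Arguments two_merge : simpl never.

Definition two_merge_cost (a b : nat) (T : seq nat) : nat :=
  1 + probe_cost (2 * (size T + 2)).+1 (size T + 2) 1 0 (rank a T)
    + rhbs_depth (size T - rank a T) (rank b T - rank a T).

Lemma two_mergeE (A B : nat) T : sorted ltn T -> uniq [:: A, B & T] ->
  two_merge A B T = (sort leq [:: A, B & T], two_merge_cost (minn A B) (maxn A B) T).
Proof.
move=> sT uT; rewrite /two_merge.
have aE : (if A < B then A else B) = minn A B by [].
have bE : (if A < B then B else A) = maxn A B by [].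
rewrite {}aE {}bE.
have AB : A != B by apply: contraTneq uT => ->; rewrite /= inE eqxx.
have -> : sort leq [:: A, B & T] = sort leq [:: maxn A B, minn A B & T].
  apply/perm_sortP => //; [exact: leq_total|exact: leq_trans|exact: anti_leq|].
  rewrite /maxn /minn; case: ifP => // _.
  by rewrite (perm_catCA [:: A] [:: B] T).
have {uT} : uniq [:: maxn A B, minn A B & T].
  rewrite -(perm_uniq (s1 := [:: A, B & T])) // /maxn /minn; case: ifP => // _.
  by rewrite (perm_catCA [:: A] [:: B] T).
have : minn A B < maxn A B by lia.
move: (minn A B) (maxn A B) => {A B AB} a b ab /= /and3P[].
rewrite inE negb_or => /andP[_ bT] aT uT.
have Ta := rank_le_size a T; have Tb := rank_le_size b T.
have [] := probe_auxE (2 * (size T + 2)).+1 (size T + 2) a T 1 0 sT aT erefl isT isT.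
move: (probe_aux _ _ _ _ _ _) => [[lo hi] c] /= lolh hiT pcE.
have sTl : sorted ltn (drop lo (take hi.-1 T)) by rewrite drop_sorted ?take_sorted.
have aTl : a \notin drop lo (take hi.-1 T).
  by apply: contra aT => /mem_drop/mem_take.
have hiT' : size (take hi.-1 T) = hi.-1 by rewrite size_takel.
rewrite rhbsE // size_drop hiT' sorted_rank_dropE ?take_sorted //; last by rewrite hiT'; lia.
rewrite sorted_rank_takeE //.
have -> : minn hi.-1 (rank a T) = rank a T by lia.
have -> /= : lo + (rank a T - lo) = rank a T by lia.
rewrite rhbsE ?drop_sorted //; last by apply: contra bT => /mem_drop.
rewrite size_drop sorted_rank_dropE //= ins_at_sorted //.
have rab : rank a T <= rank b T by apply: rank_mono; lia.
have rb : (rank a T).+1 + (rank b T - rank a T) = rank b (sort leq (a :: T)).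
  rewrite (rank_perm b _ _ (permEl (perm_sort leq (a :: T)))).
  have -> : rank b (a :: T) = (a < b) + rank b T by [].
  by rewrite ab; lia.
rewrite rb ins_at_sorted; last first.
- by rewrite mem_sort inE negb_or bT andbT; lia.
- by rewrite sort_leq_ltn //= aT.
congr (_, _); last first.
  rewrite /two_merge_cost -pcE.
  lia.
apply/perm_sortP; [exact: leq_total|exact: leq_trans|exact: anti_leq|].
by rewrite perm_cons (permEl (perm_sort leq (a :: T))).
Qed.

Definition pair_cost (x y : nat) (T : seq nat) : nat :=
  if use_2merge (size T + 2) then two_merge_cost (minn x y) (maxn x y) T
  else rhbs_depth (size T) (rank x T) + rhbs_depth (size T).+1 (rank y (x :: T)).

Lemma ins12_auxS k s : 0 < k ->
  ins12_aux k.+1 s =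
  (let Tc := ins12_aux k s in
   let x := nth 0 s k.*2 in let y := nth 0 s k.*2.+1 in
   if use_2merge k.+1.*2 then
     let res := two_merge x y Tc.1 in (res.1, Tc.2 + res.2)
   else
     let p1 := rhbs x Tc.1 in
     let T1 := ins_at p1.1 x Tc.1 in
     let p2 := rhbs y T1 in
     (ins_at p2.1 y T1, Tc.2 + p1.2 + p2.2)).
Proof.
by case: k => // k _; rewrite [in LHS]/ins12_aux -/ins12_aux !doubleS !subSS !subn0.
Qed.

(** Both branches end with the sorted list, so the state of the recursion depends only on the set of
    elements inserted so far, and the branches differ in cost alone. *)
Lemma insert_pairE x y T m (Tc := (sort leq T, m)) : uniq [:: x, y & T] ->
  (if use_2merge (size T + 2) then
     let res := two_merge x y Tc.1 in (res.1, Tc.2 + res.2)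
   else
     let p1 := rhbs x Tc.1 in
     let T1 := ins_at p1.1 x Tc.1 in
     let p2 := rhbs y T1 in
     (ins_at p2.1 y T1, Tc.2 + p1.2 + p2.2)) =
  (sort leq [:: x, y & T], m + pair_cost x y (sort leq T)).
Proof.
move=> uxy; have [xy xT yT uT] : [/\ x != y, x \notin T, y \notin T & uniq T].
  by move: uxy; rewrite /= inE negb_or => /and3P[/andP[-> ->] -> ->].
have sT := sort_leq_ltn _ uT.
have pT := permEl (perm_sort leq T).
have sortE (s t : seq nat) : perm_eq s t -> sort leq s = sort leq t.
  by move=> st; apply/perm_sortP => //; [exact: leq_total|exact: leq_trans|exact: anti_leq].
rewrite /pair_cost size_sort {}/Tc; case: ifP => _.
  rewrite (two_mergeE x y (sort leq T)) //=; last by rewrite !inE !mem_sort sort_uniq -!in_cons.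
  by congr (_, _); apply: sortE; rewrite !perm_cons.
rewrite /= (rhbsE x (sort leq T)) ?mem_sort //= ins_at_sorted ?mem_sort //.
have -> : sort leq (x :: sort leq T) = sort leq (x :: T) by apply: sortE; rewrite perm_cons.
have sxT : sorted ltn (sort leq (x :: T)) by rewrite sort_leq_ltn //= xT.
have ysxT : y \notin sort leq (x :: T) by rewrite mem_sort inE negb_or eq_sym xy.
rewrite rhbsE //= ins_at_sorted // !size_sort /=; congr (_, _).
  apply: sortE; rewrite perm_sym (perm_catCA [:: x] [:: y] T) /= perm_cons perm_sym.
  exact: permEl (perm_sort leq _).
rewrite addnA (rank_perm y _ _ (permEl (perm_sort leq (x :: T)))).
by rewrite (rank_perm y _ _ pT).
Qed.

Lemma ins12_auxE k s : 0 < k -> k.*2 <= size s -> uniq s ->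
  ins12_aux k s = (sort leq (take k.*2 s), 
    1 + \sum_(1 <= j < k) pair_cost (nth 0 s j.*2) (nth 0 s j.*2.+1) (sort leq (take j.*2 s))).
Proof.
elim: k => [//|[_|k IH]] _ ks us.
  case: s ks us => [|x [|y s]] //= _ /andP[]; rewrite inE negb_or => /andP[xy _] _.
  rewrite big_geq // take0 /=.
  congr (_, _); apply: (sorted_eq leq_trans anti_leq).
  - by case: ltngtP xy => //= /ltnW ->.
  - exact: sort_sorted leq_total _.
  by rewrite perm_sym perm_sort; case: ifP => // _; exact: permEl (perm_catC [:: x] [:: y]).
rewrite ins12_auxS // IH //; last by move: ks; rewrite !doubleS; lia.
have ks' : k.+1.*2.+1 < size s by rewrite doubleS in ks.
have tk : perm_eq (take k.+2.*2 s)
    [:: nth 0 s k.+1.*2, nth 0 s k.+1.*2.+1 & take k.+1.*2 s].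
  rewrite doubleS (take_nth 0 ks') (take_nth 0 (ltnW ks')).
  rewrite -!cats1 -catA perm_catC; exact: perm_refl.
have -> : sort leq (take k.+2.*2 s) = 
    sort leq [:: nth 0 s k.+1.*2, nth 0 s k.+1.*2.+1 & take k.+1.*2 s].
  by apply/perm_sortP => //; [exact: leq_total|exact: leq_trans|exact: anti_leq].
rewrite [in RHS]big_nat_recr // [in RHS]addnA -insert_pairE; last first.
  by rewrite -(perm_uniq tk) take_uniq.
by rewrite (size_takel (ltnW (ltnW ks'))) addn2 -doubleS.
Qed.

(** * Averaging over permutations *)

(** Here [a] and [b] are ranks among all m elements, the pair included. The corrections [.-1] and
    [b < a] convert them into ranks in the list that is actually searched. *)
Definition rank_cost (m a b : nat) : nat :=
  if use_2merge m then
    1 + probe_cost (2 * m).+1 m 1 0 (minn a b)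
      + rhbs_depth (m - 2 - minn a b) ((maxn a b).-1 - minn a b)
  else rhbs_depth (m - 2) (a - (b < a)) + rhbs_depth m.-1 b.

Lemma lt_nth_sorted (U : seq nat) a b : sorted ltn U -> a < size U -> b < size U ->
  (nth 0 U a < nth 0 U b) = (a < b).
Proof.
move=> sU aU bU; have mono := sorted_ltn_nth ltn_trans 0 sU.
case: (ltngtP a b) => [ab|ba|->]; rewrite ?ltnn //.
  exact: mono.
by apply/negbTE; rewrite -leqNgt ltnW //; apply: mono.
Qed.

Lemma rank_nth (U : seq nat) a : sorted ltn U -> a < size U -> rank (nth 0 U a) U = a.
Proof.
move=> sU aU; apply/eqP; rewrite eqn_leq -ltn_nth_rank // leqnn /=.
case: a aU => // a aU; rewrite ltnNge -ltn_nth_rank; [|by []|exact: ltnW].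
by rewrite -ltnNge lt_nth_sorted // ltnW.
Qed.

Definition drop_pair (U : seq nat) (x y : nat) := [seq z <- U | (z != x) && (z != y)].

Lemma drop_pair_perm (U : seq nat) x y : uniq U -> x \in U -> y \in U -> x != y ->
  perm_eq U [:: x, y & drop_pair U x y].
Proof.
move=> uU xU yU xy; apply: uniq_perm => //.
  by rewrite /= inE negb_or xy !mem_filter !eqxx /= andbF filter_uniq.
move=> z; rewrite !inE mem_filter; case: eqVneq => [->|_] //=; case: eqVneq => [->|_] //=.
Qed.

Lemma pair_cost_rank m (U : seq nat) a b : sorted ltn U -> size U = m ->
  a < m -> b < m -> a != b ->
  pair_cost (nth 0 U a) (nth 0 U b) (drop_pair U (nth 0 U a) (nth 0 U b)) = rank_cost m a b.
Proof.
move=> sU sz am bm ab.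
have uU : uniq U := sorted_uniq ltn_trans ltnn sU.
set x := nth 0 U a; set y := nth 0 U b; set T := drop_pair U x y.
have xU : x \in U by rewrite mem_nth ?sz.
have yU : y \in U by rewrite mem_nth ?sz.
have xy : x != y by rewrite nth_uniq ?sz.
have pU : perm_eq U [:: x, y & T] by apply: drop_pair_perm.
have rT z : rank z U = (x < z) + ((y < z) + rank z T) by rewrite (rank_perm _ _ _ pU).
have sT : size T + 2 = m by rewrite -sz (perm_size pU) /= addn2.
have rx : rank x U = a by rewrite rank_nth ?sz.
have ry : rank y U = b by rewrite rank_nth ?sz.
have xyE : (x < y) = (a < b) by rewrite lt_nth_sorted ?sz.
have yxE : (y < x) = (b < a) by rewrite lt_nth_sorted ?sz.
have := rT x; have := rT y; rewrite rx ry xyE yxE !ltnn !add0n => rTy rTx.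
rewrite /pair_cost /rank_cost /two_merge_cost sT -sT addnK; case: ifP => _.
  case: (ltngtP a b) ab => // ab _; move: rTx rTy; rewrite ab /= ltnNge ltnW //= add0n => rTx rTy.
    rewrite /minn /maxn xyE ab -rTx.
    by have -> : rank y T = b.-1 by lia.
  rewrite /minn /maxn xyE [a < b]ltnNge ltnW //= -rTy.
  by have -> : rank x T = a.-1 by lia.
have -> : rank x T = a - (b < a) by lia.
have -> : (size T).+1 = (size T + 2).-1 by lia.
have -> // : rank y (x :: T) = b.
have -> : rank y (x :: T) = (x < y) + rank y T by [].
by rewrite xyE -rTy.
Qed.

(** The list before the insertion is expressed by the list after it, because the latter is what the
    symmetry argument keeps fixed. *)
Lemma sort_take_drop_pair (s : seq nat) m : uniq s -> m.+1 < size s ->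
  sort leq (take m s) = drop_pair (sort leq (take m.+2 s)) (nth 0 s m) (nth 0 s m.+1).
Proof.
move=> us ms; rewrite /drop_pair.
have E : take m.+2 s = rcons (rcons (take m s) (nth 0 s m)) (nth 0 s m.+1).
  by rewrite (take_nth 0 ms) (take_nth 0 (ltnW ms)).
have uE : uniq (take m.+2 s) by rewrite take_uniq.
apply: (sorted_eq leq_trans anti_leq).
- exact: sort_sorted leq_total _.
- by apply: sorted_filter; [exact: leq_trans|exact: sort_sorted leq_total _].
rewrite perm_sort perm_sym (perm_trans (perm_filter _ (permEl (perm_sort leq _)))) //.
rewrite E !filter_rcons !eqxx /= andbF.
move: uE; rewrite E !rcons_uniq mem_rcons inE negb_or => /andP[/andP[_ n2] /andP[n1 _]].
have -> // : [seq x <- take m s | x != nth 0 s m & x != nth 0 s m.+1] = take m s.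
apply/all_filterP/allP => z zs; apply/andP; split.
  by apply: contraNneq n1 => <-.
by apply: contraNneq n2 => <-.
Qed.

Definition rank_cost_sum (m : nat) : nat := \sum_(a < m) \sum_(b < m | a != b) rank_cost m a b.

Lemma sum_pair_cost m (U : seq nat) : sorted ltn U -> size U = m ->
  \sum_(x <- U) \sum_(y <- U | x != y) pair_cost x y (drop_pair U x y) = rank_cost_sum m.
Proof.
move=> sU sz; rewrite (big_nth 0) sz big_mkord; apply: eq_bigr => a _.
rewrite (big_nth 0) sz big_mkord; apply: eq_big => [b|b ab].
  by rewrite nth_uniq ?sz //; apply: sorted_uniq sU; [exact: ltn_trans|exact: ltnn].
rewrite (pair_cost_rank m) //.
by move: ab; rewrite nth_uniq ?sz //; apply: sorted_uniq sU; [exact: ltn_trans|exact: ltnn].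
Qed.

Definition perm_seq n (sigma : {perm 'I_n}) : seq nat := [seq val (sigma i) | i <- enum 'I_n].

Lemma size_perm_seq n (sigma : {perm 'I_n}) : size (perm_seq n sigma) = n.
Proof. by rewrite size_map size_enum_ord. Qed.

Lemma uniq_perm_seq n (sigma : {perm 'I_n}) : uniq (perm_seq n sigma).
Proof. by rewrite map_inj_uniq ?enum_uniq // => i j /val_inj/perm_inj. Qed.

Lemma nth_perm_seq n (sigma : {perm 'I_n}) (i : 'I_n) : nth 0 (perm_seq n sigma) i = sigma i.
Proof. by rewrite (nth_map i) ?size_enum_ord // nth_ord_enum. Qed.

(** Written as a filter on positions, the prefix is seen to keep its set of values when the
    positions below [m] are permuted. *)
Lemma take_perm_seq n (sigma : {perm 'I_n}) m :
  take m (perm_seq n sigma) = [seq val (sigma i) | i : 'I_n <- [seq i : 'I_n <- enum 'I_n | i < m]].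
Proof.
rewrite /perm_seq -map_take; congr map.
have : map (@nat_of_ord n) (take m (enum 'I_n)) = map (@nat_of_ord n) [seq i : 'I_n <- enum 'I_n
    | i < m].
  rewrite map_take val_enum_ord -(filter_map (@nat_of_ord n) (fun i => i < m)) val_enum_ord
      take_iota.
  rewrite -[X in _ = seq.filter _ (iota _ X)](subnKC (geq_minr m n)) iotaD filter_cat add0n.
  rewrite -[LHS]cats0; congr (_ ++ _); apply/esym.
    by apply/all_filterP/allP => i; rewrite mem_iota; lia.
  by apply/eqP; rewrite -[_ == _]negbK -has_filter; apply/hasPn => i; rewrite mem_iota; lia.
by move/(inj_map val_inj) ->.
Qed.

(** A permutation that sends a to u and b to v: b first goes to the preimage of v under the
    transposition of a and u, which is applied next. *)
Definition perm2 (T : finType) (a b u v : T) : {perm T} :=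
  (tperm b (tperm a u v) * tperm a u)%g.
Arguments perm2 {T} a b u v.

Lemma perm2P (T : finType) (a b u v : T) : a != b -> u != v ->
  perm2 a b u v a = u /\ perm2 a b u v b = v.
Proof.
move=> ab uv; rewrite /perm2 !permM tpermL tpermK; split=> //.
have va : tperm a u v != a by rewrite -[X in _ != X](tpermR a u) (inj_eq perm_inj) eq_sym.
have -> : tperm b (tperm a u v) a = a by rewrite tpermD // eq_sym.
by rewrite tpermL.
Qed.

Lemma perm2_lt n (m : nat) (a b u v i : 'I_n) : a < m -> b < m -> u < m -> v < m ->
  (perm2 a b u v i < m) = (i < m).
Proof.
move=> am bm um vm; have lt_tperm (x y z : 'I_n) : x < m -> y < m -> (tperm x y z < m) = (z < m).
  by case: tpermP => [->|->|_ _] // -> ->.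
by rewrite /perm2 permM !lt_tperm.
Qed.

(* Permuting the first m + 2 positions changes neither the sum over all permutations nor the sorted
   list of the first m + 2 values, so the last two of these values may be averaged over all ordered
   pairs of ranks. *)
Lemma sum_perm_pair n (m : nat) (a b : 'I_n) : a = m :> nat -> b = m.+1 :> nat ->
  m.+2 * m.+1 * \sum_(sigma : {perm 'I_n})
    pair_cost (sigma a) (sigma b) (sort leq (take m (perm_seq n sigma))) =
  n`! * rank_cost_sum m.+2.
Proof.
move=> am bm; have ab : a != b by rewrite -val_eqE /= am bm; lia.
have mn : m.+1 < n by rewrite -bm.
pose U sigma := sort leq (take m.+2 (perm_seq n sigma)).
pose G (sigma : {perm 'I_n}) (u v : 'I_n) := 
  pair_cost (sigma u) (sigma v) (drop_pair (U sigma) (sigma u) (sigma v)).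
have GE (sigma : {perm 'I_n}) : pair_cost (sigma a) (sigma b) (sort leq (take m (perm_seq n
    sigma))) = G sigma a b.
  rewrite /G /U -(nth_perm_seq _ _ a) -(nth_perm_seq _ _ b) am bm.
  by rewrite -sort_take_drop_pair ?uniq_perm_seq // size_perm_seq.
under eq_bigr do rewrite GE.
have shift (u v : 'I_n) : u < m.+2 -> v < m.+2 -> u != v ->
    \sum_sigma G sigma a b = \sum_sigma G sigma u v.
  move=> um vm uv; rewrite (reindex_inj (mulgI (perm2 a b u v))); apply: eq_bigr => sigma _.
  have [pa pb] := perm2P _ a b u v ab uv.
  rewrite /G !(permM (perm2 a b u v) sigma) pa pb; suff -> : U (perm2 a b u v * sigma)%g = U
      sigma by [].
  apply/perm_sortP; [exact: leq_total|exact: leq_trans|exact: anti_leq|].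
  rewrite !take_perm_seq.
  have -> : [seq val ((perm2 a b u v * sigma)%g i) | i : 'I_n <- [seq i : 'I_n <- enum 'I_n | i <
      m.+2]] =
      [seq val (sigma i) | i <- [seq perm2 a b u v i | i <- [seq i : 'I_n <- enum 'I_n | i <
          m.+2]]].
    by rewrite -map_comp; apply: eq_map => i /=; rewrite (permM (perm2 a b u v) sigma).
  apply: perm_map; apply: uniq_perm.
  - by rewrite (map_inj_uniq perm_inj); apply/filter_uniq/enum_uniq.
  - exact/filter_uniq/enum_uniq.
  move=> i; rewrite mem_filter mem_enum andbT.
  rewrite -[i in LHS](permKV (perm2 a b u v)) (mem_map perm_inj).
  rewrite mem_filter mem_enum andbT.
  rewrite -[i in RHS](permKV (perm2 a b u v)) perm2_lt //; rewrite ?am ?bm //; lia.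
(* For a fixed permutation, ordered pairs of distinct positions below m + 2 correspond to ordered
   pairs of distinct elements of [U sigma]. *)
have inner (sigma : {perm 'I_n}) : \sum_(u < n | u < m.+2) \sum_(v < n | (v < m.+2) && (u != v))
    G sigma u v =
    rank_cost_sum m.+2.
  have sU : sorted ltn (U sigma) by rewrite sort_leq_ltn // take_uniq ?uniq_perm_seq.
  have szU : size (U sigma) = m.+2 by rewrite size_sort size_takel ?size_perm_seq.
  rewrite -(sum_pair_cost _ _ sU szU).
  have sumU (P : pred nat) (F : nat -> nat) : 
      \sum_(x <- U sigma | P x) F x = \sum_(u < n | (u < m.+2) && P (sigma u)) F (sigma u).
    rewrite (perm_big _ (permEl (perm_sort leq _))) take_perm_seq big_map big_filter_cond.
    by rewrite big_enum_cond.
  rewrite sumU; apply: eq_big => [u|u um]; first by rewrite andbT.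
  rewrite sumU; apply: eq_bigl => v.
  by rewrite (inj_eq val_inj) (inj_eq perm_inj).
have -> : m.+2 * m.+1 * \sum_sigma G sigma a b =
    \sum_(u < n | u < m.+2) \sum_(v < n | (v < m.+2) && (u != v)) \sum_sigma G sigma a b.
  have cardlt : #|[pred u : 'I_n | u < m.+2]| = m.+2.
    rewrite -[RHS]card_ord -(card_image (f := widen_ord mn)) //; last first.
      by move=> x y /(congr1 val) /= xy; apply: val_inj.
    apply: eq_card => u; rewrite !inE; apply/idP/imageP => [um|[x _ ->] /=]; last exact: ltn_ord.
    by exists (Ordinal um) => //; apply: val_inj.
  rewrite -mulnA -[in LHS]cardlt -sum_nat_const; apply: eq_bigr => u um.
  rewrite sum_nat_const; congr (_ * _).
  have := cardD1 u [pred u : 'I_n | u < m.+2]; rewrite cardlt um add1n => -[e]; rewrite [LHS]e.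
  by apply: eq_card => v; rewrite [RHS]unfold_in !inE andbC eq_sym.
transitivity (\sum_(sigma : {perm 'I_n}) rank_cost_sum m.+2); last first.
  by rewrite sum_nat_const card_Sn.
under [RHS]eq_bigr => sigma _ do rewrite -(inner sigma).
rewrite [RHS]exchange_big /=; apply: eq_bigr => u um.
rewrite [RHS]exchange_big /=; apply: eq_bigr => v /andP[vm uv].
exact: shift.
Qed.

(** The external path length of the RHBS tree with [t] leaves, which searches a list of [t.-1]
    elements. *)
Definition ext_path (t : nat) : nat := \sum_(j < t) rhbs_depth t.-1 j.

Lemma sum_ord_neq n (j : 'I_n.+1) (F : 'I_n.+1 -> nat) :
  \sum_(i | i != j) F i = \sum_(k < n) F (lift j k).
Proof.
rewrite (reindex_omap (lift j) (unlift j)) /=; last first.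
  by move=> i; case: unliftP => [k ->|->]; rewrite ?eqxx.
by apply: eq_bigl => k; rewrite liftK eq_sym eqxx neq_lift.
Qed.

(** Once the rank b of the second element is fixed, [lift b] enumerates the ranks of the first; the
    rank of the first in the list without the second then runs over all m + 1 gaps, independently of
    b. *)
Lemma rank_cost_sum_single m : ~~ use_2merge m.+2 ->
  rank_cost_sum m.+2 = m.+2 * ext_path m.+1 + m.+1 * ext_path m.+2.
Proof.
move=> /negbTE nu; rewrite /rank_cost_sum.
under eq_bigr => a _ do under eq_bigr => b _ do rewrite /rank_cost nu subSS subSS subn0 /=.
rewrite (exchange_big_dep predT) //=.
have swap (F : nat -> nat -> nat) : \sum_(b < m.+2) \sum_(a < m.+2 | a != b) F a b =
    \sum_(b < m.+2) \sum_(k < m.+1) F (lift b k) b.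
  by apply: eq_bigr => b _; rewrite sum_ord_neq.
rewrite (swap (fun a b => rhbs_depth m (a - (b < a)) + rhbs_depth m.+1 b)).
under eq_bigr => b _ do rewrite big_split /= sum_nat_const card_ord.
rewrite big_split /= -big_distrr; congr (_ + _).
rewrite -[X in X * _]card_ord -sum_nat_const; apply: eq_bigr => b _; apply: eq_bigr => k _.
by congr rhbs_depth; rewrite /= /bump; case: leqP => bk; lia.
Qed.

(** The factor 2 accounts for the order of the pair. If the smaller element has rank a, the larger
    one has m + 1 - a possible places, which are exactly the gaps of the list searched in Step 4. *)
Lemma rank_cost_sum_double m : use_2merge m.+2 ->
  rank_cost_sum m.+2 = 2 * \sum_(a < m.+2)
    ((m.+1 - a) * (1 + probe_cost (2 * m.+2).+1 m.+2 1 0 a) + ext_path (m.+1 - a)).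
Proof.
move=> nu; rewrite /rank_cost_sum.
under eq_bigr => a _ do under eq_bigr => b _ do rewrite /rank_cost nu.
pose H (a b : nat) := 1 + probe_cost (2 * m.+2).+1 m.+2 1 0 a + rhbs_depth (m.+2 - 2 - a) (b.-1 -
    a).
have split2 : \sum_(a < m.+2) \sum_(b < m.+2 | a != b) H (minn a b) (maxn a b) =
    2 * \sum_(a < m.+2) \sum_(b < m.+2 | a < b) H a b.
  rewrite mul2n -addnn.
  rewrite [X in _ = _ + X](exchange_big_dep predT) //= -big_split /=.
  apply: eq_bigr => a _; rewrite (bigID (fun b : 'I__ => a < b)) /=; congr (_ + _).
    apply: eq_big => [b|b /andP[_ ab]]; first by rewrite neq_ltn; case: ltngtP.
    by rewrite /minn /maxn ab.
  apply: eq_big => [b|b]; first by rewrite -val_eqE /=; case: ltngtP.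
  by move=> /andP[_ /negbTE ab]; rewrite /minn /maxn ab.
rewrite (split2) {split2}; congr (_ * _); apply: eq_bigr => a _.
have -> : \sum_(b < m.+2 | a < b) H a b = \sum_(a.+1 <= b < m.+2) H a b.
  by rewrite big_geq_mkord.
rewrite -[a.+1]add0n big_addn big_mkord.
rewrite /H big_split /= sum_nat_const card_ord subSS; congr (_ + _).
by apply: eq_bigr => j _; congr rhbs_depth; lia.
Qed.

(** * External path lengths *)

Lemma rhbs_depth_le k L t : 0 < L -> L <= 2 ^ k -> rhbs_depth L.-1 t + (t < 2 ^ k - L) <= k.
Proof.
case: L => // L _ Lk; have [lo hi] := up_log_le_itv L.+1 isT.
rewrite /rhbs_depth /=; set k' := up_log 2 L.+1 in lo hi *.
have : k' <= k by apply: up_log_min.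
rewrite leq_eqVlt => /orP[/eqP e|]; last by lia.
rewrite -{}e {k Lk}; case: k' lo hi => [|k] lo hi; last by lia.
by have -> : 2 ^ 0 - L.+1 = 0 by lia.
Qed.

Lemma sum_lt_indicator n s : \sum_(j < n) (j < s : nat) = minn s n.
Proof.
elim: n => [|n IH]; first by rewrite big_ord0 minn0.
by rewrite big_ord_recr /= IH; lia.
Qed.

(** There are 2^k - t leaves at depth k - 1 and the others are at depth k. At t = 2^(k-1) the
    formulas for k and k - 1 agree, so adjacent octaves may share an end point. *)
Lemma ext_pathE k t : 2 ^ k <= t.*2 -> t <= 2 ^ k -> ext_path t + 2 ^ k = k.+1 * t.
Proof.
case: t => [|t]; first by have := expn_gt0 2 k; lia.
rewrite leq_eqVlt => /orP[/eqP e _|lo hi]; rewrite /ext_path.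
  have [k' ek] : exists k', k = k'.+1 by case: k e => [|k] e; [move: e; lia|exists k].
  subst k; move: e; rewrite expnS => e.
  have e' : t.+1 = 2 ^ k' by lia.
  under eq_bigr => j _.
    rewrite (rhbs_depthE k') /=; [|lia|lia].
    have -> : (j < 2 ^ k' - t.+1) = false by lia.
    rewrite subn0; over.
  rewrite sum_nat_const card_ord; lia.
under eq_bigr => j _ do rewrite (rhbs_depthE k) //.
have : \sum_(j < t.+1) (k - (j < 2 ^ k - t.+1)) + \sum_(j < t.+1) (j < 2 ^ k - t.+1 : nat)
    = t.+1 * k.
  rewrite -big_split -[X in X * _]card_ord -sum_nat_const; apply: eq_bigr => j _ /=.
  by case: k lo hi => [|k] lo hi; [have -> : (j < 2 ^ 0 - t.+1) = false by lia|lia].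
rewrite sum_lt_indicator => H; rewrite mulSn; move: H; rewrite [(t.+1 * k)%N]mulnC.
move: (k * t.+1)%N (\sum_(j < _) _)%N => A B; lia.
Qed.

Lemma ext_path0 : ext_path 0 = 0.
Proof. by rewrite /ext_path big_ord0. Qed.

Import Order.TTheory GRing.Theory Num.Theory.
Import numFieldNormedType.Exports.
Local Open Scope ring_scope.

Lemma ins12_complexityE (R : realType) (k : nat) : (0 < k)%N ->
  ins12_complexity R k.*2 = 1 + \sum_(1 <= j < k)
    (rank_cost_sum j.*2.+2)%:R / (j.*2.+2 * j.*2.+1)%:R.
Proof.
move=> k0; set n := k.*2.
have costE (sigma : {perm 'I_n}) : ins12_cost sigma = (1 + \sum_(1 <= j < k)
    pair_cost (nth 0 (perm_seq n sigma) j.*2) (nth 0 (perm_seq n sigma) j.*2.+1)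
      (sort leq (take j.*2 (perm_seq n sigma))))%N.
  rewrite /ins12_cost /ins12 -/(perm_seq n sigma) size_perm_seq doubleK.
  by rewrite ins12_auxE ?uniq_perm_seq ?size_perm_seq.
have f0 : (n`!)%:R != 0 :> R by rewrite pnatr_eq0 -lt0n fact_gt0.
rewrite /ins12_complexity (eq_bigr _ (fun sigma _ => costE sigma)) big_split /=.
rewrite sum_nat_const muln1 (card_Sn n) natrD mulrDl divff //; congr (_ + _).
rewrite exchange_big /= natr_sum mulr_suml; apply: eq_big_nat => j /andP[j1 jk].
have an : (j.*2 < n)%N by rewrite ltn_double.
have bn : (j.*2.+1 < n)%N by rewrite /n; lia.
have := sum_perm_pair n j.*2 (Ordinal an) (Ordinal bn) erefl erefl.
set S := (X in (_ * X = _)%N -> _) => E.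
have -> : (\sum_(i : 'S_n) pair_cost (nth 0 (perm_seq n i) j.*2)
    (nth 0 (perm_seq n i) j.*2.+1) (sort leq (take j.*2 (perm_seq n i))))%N = S.
  apply: eq_bigr => sigma _.
  by rewrite -(nth_perm_seq n sigma (Ordinal an)) -(nth_perm_seq n sigma (Ordinal bn)).
have d0 : (j.*2.+2 * j.*2.+1)%:R != 0 :> R by rewrite pnatr_eq0.
apply: (mulIf d0); apply: (mulIf f0); rewrite mulrAC mulfVK // [RHS]mulrAC [in RHS]mulrAC.
by rewrite mulfVK // -!natrM mulnC E mulnC.
Qed.

(** The coefficient 1/6 makes the quadratic terms of the bounds for k and k + 1 agree at M = 2^k, so
    that the induction passes from one octave to the next. *)
Lemma ext_path_sum_le (R : realType) k M : (2 ^ k <= M.*2)%N -> (M <= 2 ^ k)%N -> (0 < M)%N ->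
  (\sum_(t < M.+1) ext_path t)%N%:R <=
  (k.+1%:R * M%:R * (M%:R + 1) / 2 - 2 ^+ k * M%:R + (2 ^+ k) ^+ 2 / 6 : R).
Proof.
elim: M k => // M IH k lo hi _; rewrite big_ord_recr natrD /=.
have := ext_pathE k M.+1 lo hi => /(congr1 (fun n => n%:R : R)).
rewrite natrD natrX natrM => ext.
case: (posnP M) => [M0|M0].
  subst M; rewrite big_ord_recr big_ord0 ext_path0 /= add0r.
  case: k lo hi ext => [|[|k]] lo hi ext; [lra|lra|].
  by move: lo; rewrite !expnS; have := expn_gt0 2 k; lia.
have P0 : 0 <= (2 ^+ k : R) by rewrite exprn_ge0.
case: (leqP (2 ^ k) M.*2) => kM.
  have := IH k kM (ltnW hi) M0; rewrite -[M.+1%:R]natr1 -[k.+1%:R]natr1 in ext *; nra.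
case: k lo hi ext P0 kM => [|k] lo hi ext P0 kM; first by move: hi; rewrite expn0; lia.
have e : (2 ^ k = M.+1)%N by move: lo kM hi; rewrite !expnS; lia.
have eR : 2 ^+ k = M%:R + 1 :> R by rewrite -natrX e natr1.
have := IH k; rewrite e => /(_ _ _ M0) IHk.
have := IHk ltac:(lia) (leqnSn M).
have M1 : 1 <= M%:R :> R by rewrite ler1n.
move: ext; rewrite exprS eR -[M.+1%:R]natr1 -[k.+2%:R]natr1 -[k.+1%:R]natr1; lra.
Qed.

(** * Expected cost of inserting the smaller element *)

Lemma sum_weights (R : realType) (q s : nat) : (s <= q)%N ->
  (\sum_(t < s) (q.-1 - t))%N%:R = s%:R * q%:R - s%:R * (s%:R + 1) / 2 :> R.
Proof.
elim: s => [|s IH] sq; first by rewrite big_ord0; lra.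
rewrite big_ord_recr /= natrD IH; last exact: ltnW.
have -> : (q.-1 - s)%:R = q%:R - s%:R - 1 :> R.
  by rewrite -subn1 -subnDA add1n natrB // -natr1; lra.
by rewrite -[s.+1%:R]natr1; lra.
Qed.

(** RHBS saves a comparison at the leftmost gaps, which are those of largest weight [q.-1 - t]. *)
Lemma segment_cost (k L q : nat) : (L <= q)%N -> (L <= 2 ^ k)%N ->
  (\sum_(t < L) (q.-1 - t) * rhbs_depth L.-1 t + \sum_(t < minn (2 ^ k - L) L) (q.-1 - t)
   <= k * \sum_(t < L) (q.-1 - t))%N.
Proof.
move=> Lq Lk; rewrite (big_ord_widen L (fun t => q.-1 - t)%N (geq_minr _ _)).
rewrite [X in (_ + X <= _)%N]big_mkcond.
rewrite -big_split big_distrr; apply: leq_sum => t _ /=.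
have := rhbs_depth_le k L t (leq_trans (leq_ltn_trans (leq0n t) (ltn_ord t)) (leqnn _)) Lk.
have tL := ltn_ord t; have -> : (t < minn (2 ^ k - L) L)%N = (t < 2 ^ k - L)%N by lia.
by case: (t < _)%N => D; rewrite mulnC; nia.
Qed.

(* With w = P - (1 - c) x this is x w - w^2 / 2, the total weight of the w gaps of a segment that
   RHBS reaches with one comparison less than lg P; the gap at distance v from the right end of
   the list has weight v, the number of positions left for the larger element. *)
Definition sig (R : realType) (c P x : R) : R :=
  (2 - c) * P * x - P ^+ 2 / 2 - (7 / 4 - 2 * c) * x ^+ 2.

(** The term 3 x absorbs the replacement of x and c x by their integer parts q and q'. *)
Lemma segment_bound (R : realType) (c x : R) (k q q' : nat) :
  0 < c -> c ^+ 2 = 1 / 2 -> 1 <= x ->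
  q%:R <= x < q%:R + 1 -> q'%:R <= c * x < q'%:R + 1 ->
  x * (1 - c) <= 2 ^+ k <= 2 * x * (1 - c) ->
  (\sum_(t < q - q') (q.-1 - t) * rhbs_depth (q - q').-1 t)%N%:R <=
  k%:R * (q%:R * (q%:R - 1) / 2 - q'%:R * (q'%:R - 1) / 2) - sig R c (2 ^+ k) x + 3 * x.
Proof.
move=> c0 c2 x1 /andP[qx xq] /andP[qx' xq'] /andP[kx xk].
have /andP[c1 c1'] : 7 / 10 < c < 71 / 100 by apply/andP; split; nra.
have q'q : (q' <= q)%N.
  by rewrite -ltnS -(ltr_nat R) -natr1; nra.
set L := (q - q')%N; have LR : L%:R = q%:R - q'%:R :> R by rewrite natrB.
have LP : (L <= 2 ^ k)%N.
  by rewrite -ltnS -(ltr_nat R) -natr1 natrX LR; nra.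
have := segment_cost k L q (leq_subr _ _) LP; rewrite -(ler_nat R) natrD natrM.
rewrite !sum_weights ?leq_subr //; last by rewrite (leq_trans (geq_minr _ _)) ?leq_subr.
rewrite LR; set s := minn _ _.
have sL : s%:R <= L%:R :> R by rewrite ler_nat geq_minr.
have s0 : 0 <= s%:R :> R by rewrite ler0n.
have sw : 2 ^+ k - x * (1 - c) - 1 <= s%:R.
  by rewrite /s /minn; case: ifP => _; [rewrite natrB // natrX LR|rewrite LR]; nra.
rewrite LR in sL.
set w := 2 ^+ k - x * (1 - c) in sw.
have main : x * w - w ^+ 2 / 2 - 3 * x <= s%:R * q%:R - s%:R * (s%:R + 1) / 2.
  have h1 : s%:R * (x - 1) <= s%:R * q%:R by apply: ler_wpM2l => //; lra.
  (* The product is the difference between the actual saving s x - s^2 / 2 and the ideal one w x -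
     w^2 / 2, and s >= w - 1. *)
  suff : - (2 * x) <= (s%:R - w) * (x - (s%:R + w) / 2) - 3 / 2 * s%:R + x by lra.
  have sx : s%:R <= x * (1 - c) + 1 by lra.
  have wx : w <= x * (1 - c) by rewrite /w; lra.
  have g0 : 0 <= x - (s%:R + w) / 2 by nra.
  have g1 : x - (s%:R + w) / 2 <= x by rewrite /w; lra.
  have : - x <= (s%:R - w) * (x - (s%:R + w) / 2) by nra.
  nra.
have -> : sig R c (2 ^+ k) x = x * w - w ^+ 2 / 2.
  have c2x : c ^+ 2 * x ^+ 2 = x ^+ 2 / 2 by rewrite c2; lra.
  by rewrite /sig /w; lra.
move: main; lra.
Qed.

Lemma floor_scaled_bounds (R : realType) (c : R) (i r : nat) : 0 < c -> c ^+ 2 = 1 / 2 ->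
  (floor_scaled i r)%:R <= i%:R * c ^+ r < (floor_scaled i r)%:R + 1.
Proof.
move=> c0 c2; have := floor_scaledP i r; set q := floor_scaled i r => /andP[lo hi].
have cr0 : 0 <= c ^+ r by rewrite exprn_ge0 // ltW.
have cE : c ^+ r ^+ 2 * 2 ^+ r = 1.
  have h : 1 / 2 * 2 = 1 :> R by lra.
  by rewrite -exprM mulnC exprM c2 -exprMn h expr1n.
have x0 : 0 <= i%:R * c ^+ r by rewrite mulr_ge0.
have sq : (i%:R * c ^+ r) ^+ 2 * 2 ^+ r = i%:R ^+ 2 by rewrite exprMn -mulrA cE mulr1.
have t0 : 0 < 2 ^+ r :> R by rewrite exprn_gt0.
move: lo hi; rewrite -(ler_nat R) -(ltr_nat R) !natrM !natrX -[q.+1%:R]natr1 => lo hi.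
apply/andP; split.
  rewrite -(ler_pXn2r (isT : (0 < 2)%N)) ?nnegrE //; try lra.
  by rewrite -(ler_pM2r t0) sq.
rewrite -(ltr_pXn2r (isT : (0 < 2)%N)) ?nnegrE //; last by rewrite addr_ge0.
by rewrite -(ltr_pM2r t0) sq.
Qed.

(** This justifies the fuel of the probe: it stops once the remaining scaled length has integer part
    at most 1, which happens by round 2 i + 1 at the latest. *)
Lemma floor_scaled_small i r : (2 * i <= r)%N -> (floor_scaled i r <= 1)%N.
Proof.
move=> ir; have /andP[lo _] := floor_scaledP i r; rewrite leqNgt; apply/negP => q2.
have : (2 ^ 2 * 2 ^ (2 * i) <= i ^ 2)%N.
  by apply: leq_trans lo; rewrite leq_mul ?leq_exp2r ?leq_exp2l.
rewrite leqNgt => /negP[]; rewrite [(2 * i)%N]mulnC expnM -expnMn ltn_exp2r //.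
have := ltn_expl i (isT : 1 < 2)%N; lia.
Qed.

(* The solution Y(P, x) of Y(P, x) = x^2 / 4 - sig P x - sig P (c x) + Y(P / 2, x / 2): Y is
   homogeneous of degree 2, so the last term is Y(P, x) / 4. *)
Definition even_tail (R : realType) (c P x : R) : R :=
  4 / 3 * (x ^+ 2 / 4 - sig R c P x - sig R c P (c * x)).

Definition tail_bound (R : realType) (c : R) (d : bool) (P x : R) : R :=
  if d then even_tail R c (P / 2) (c * x) - sig R c P x else even_tail R c P x.

(** The ideal segment length x (1 - c) lies between P / 2 and P. The flag [d] tells that it is at
    most c P, so that the next segment, shorter by the factor c, already fits into P / 2. *)
Definition depth_window (R : realType) (c : R) (d : bool) (P x : R) : Prop :=
  if d then x * (1 - c) <= c * P /\ P <= 2 * x * (1 - c)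
  else x * (1 - c) <= P /\ c * P <= x * (1 - c).

Lemma sig_le (R : realType) (c P x : R) : 7 / 10 < c < 71 / 100 -> 0 <= P -> 0 <= x ->
  sig R c P x <= 13 / 10 * (P * x).
Proof.
move=> /andP[c1 c1'] P0 x0; rewrite /sig.
have : 0 <= (7 / 4 - 2 * c) * x ^+ 2 by rewrite mulr_ge0 ?exprn_ge0 //; lra.
have : 0 <= P ^+ 2 by rewrite exprn_ge0.
have : 0 <= (c - 7 / 10) * (P * x) by rewrite mulr_ge0 ?mulr_ge0 //; lra.
lra.
Qed.

(** A crude bound for the end of the recursion, where x is at most 3 and the error term 100 x
    outweighs it. *)
Lemma tail_bound_ge (R : realType) (c P x : R) (d : bool) : 7 / 10 < c < 71 / 100 ->
  0 <= P -> 0 <= x -> - (4 * (P * x)) <= tail_bound R c d P x.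
Proof.
move=> cb P0 x0; have /andP[c1 c1'] := cb.
have even P' y : 0 <= P' -> 0 <= y -> - (4 * (P' * y)) <= even_tail R c P' y.
  move=> P'0 y0; have cy0 : 0 <= c * y by rewrite mulr_ge0 //; lra.
  have := sig_le R c P' y cb P'0 y0; have := sig_le R c P' (c * y) cb P'0 cy0.
  rewrite /even_tail; have : 0 <= (71 / 100 - c) * (P' * y) by rewrite mulr_ge0 ?mulr_ge0 //; lra.
  have : 0 <= P' * y by rewrite mulr_ge0.
  have : 0 <= y ^+ 2 by rewrite exprn_ge0.
  lra.
case: d => /=; last exact: even.
have cx0 : 0 <= c * x by rewrite mulr_ge0 //; lra.
have := sig_le R c P x cb P0 x0; have := even (P / 2) (c * x) ltac:(lra) cx0.
have : 0 <= (71 / 100 - c) * (P * x) by rewrite mulr_ge0 ?mulr_ge0 //; lra.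
have : 0 <= P * x by rewrite mulr_ge0.
lra.
Qed.

Lemma even_tail_step (R : realType) (c P x : R) : c ^+ 2 = 1 / 2 ->
  even_tail R c P x =
  x ^+ 2 / 4 - sig R c P x + (even_tail R c (P / 2) (c * (c * x)) - sig R c P (c * x)).
Proof.
by move=> c2; rewrite mulrA -expr2 c2 /even_tail /sig; lra.
Qed.

Lemma probe_costS f i r lo l : probe_cost f.+1 i r lo l =
  (if i.-1 <= alpha_idx i r then rhbs_depth (i.-2 - lo) (l - lo)
   else if l < alpha_idx i r then (rhbs_depth ((alpha_idx i r).-1 - lo) (l - lo)).+1
   else (probe_cost f i r.+1 (alpha_idx i r) l).+1)%N.
Proof. by []. Qed.

Lemma rhbs_depth00 : rhbs_depth 0 0 = 0%N.
Proof. by rewrite /rhbs_depth up_log1. Qed.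

(** Gaps are counted from the first one not yet excluded. All of them pay for the probe; then the
    first q - q' go to Step 3 and the others to the next round. *)
Lemma probe_sum_step (f i r q : nat) (q' := floor_scaled i r) : 
  (q' <= q)%N -> (q <= i)%N -> (2 <= q')%N ->
  (\sum_(t < q) (q.-1 - t) * probe_cost f.+1 i r (i - q) (i - q + t) =
   \sum_(t < q) (q.-1 - t) + \sum_(t < q - q') (q.-1 - t) * rhbs_depth (q - q').-1 t
   + \sum_(t < q') (q'.-1 - t) * probe_cost f i r.+1 (i - q') (i - q' + t))%N.
Proof.
move=> qq' qi q'2.
have jE : alpha_idx i r = (i - q')%N by [].
pose g (t : nat) := (if t < q - q' then rhbs_depth (q - q').-1 t
  else probe_cost f i r.+1 (i - q') (i - q' + (t - (q - q'))))%N.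
have -> : (\sum_(t < q) (q.-1 - t) * probe_cost f.+1 i r (i - q) (i - q + t) =
    \sum_(t < q) (q.-1 - t) + \sum_(t < q) (q.-1 - t) * g t)%N.
  rewrite -big_split; apply: eq_bigr => t _ /=; have tq := ltn_ord t.
  rewrite probe_costS jE; have -> : (i.-1 <= i - q')%N = false by lia.
  have -> : (i - q + t < i - q')%N = (t < q - q')%N by lia.
  rewrite /g; case: ifP => tL.
    have -> : ((i - q').-1 - (i - q) = (q - q').-1)%N by lia.
    have -> : (i - q + t - (i - q) = t)%N by lia.
    by rewrite mulnS.
  have -> : (i - q + t = i - q' + (t - (q - q')))%N by lia.
  by rewrite mulnS.
rewrite -addnA; congr (_ + _)%N.
rewrite -(big_mkord xpredT (fun t => (q.-1 - t) * g t)%N) (big_cat_nat _ (n := q - q')) ?leq_subr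
    //=.
congr (_ + _)%N.
  rewrite big_mkord; apply: eq_bigr => t _; by rewrite /g ltn_ord.
rewrite -{1}[(q - q')%N]add0n big_addn subKn // big_mkord; apply: eq_bigr => t _.
have tq := ltn_ord t; rewrite /g; have -> : (t + (q - q') < q - q')%N = false by lia.
by rewrite addnK; congr (_ * _)%N; lia.
Qed.

(* Before round [r] the suffix not yet excluded has ideal length x = i 2^(-(r-1)/2), and [2 ^ k] is
   the power of two to which RHBS rounds the length (1 - 2^(-1/2)) x of the segment split off by
   round [r].  That power is halved by every other round, namely by this one iff [d] holds, which
   yields a recursion of period two for the leading term of the cost. *)
Lemma probe_tail (R : realType) (c : R) (i f r k : nat) (d : bool) (x : R)
    (q := floor_scaled i r.-1) :
  0 < c -> c ^+ 2 = 1 / 2 -> (0 < r)%N -> (f + r = (2 * i).+2)%N -> (2 <= q)%N ->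
  x = i%:R * c ^+ r.-1 -> depth_window R c d (2 ^+ k) x ->
  (\sum_(t < q) (q.-1 - t) * probe_cost f i r (i - q) (i - q + t))%N%:R <=
  (k.+1%:R * (q%:R * (q%:R - 1) / 2) + tail_bound R c d (2 ^+ k) x + 100 * x : R).
Proof.
move=> c0 c2.
have /andP[c1 c1'] : 7 / 10 < c < 71 / 100 by apply/andP; split; nra.
elim: f r k d x @q => [|f IH] r k d x q r0 fr q2 xE win.
  have := floor_scaled_small i r.-1; rewrite -/q => /(_ ltac:(lia)); lia.
have /andP[qx xq] : q%:R <= x < q%:R + 1 by rewrite xE floor_scaled_bounds.
have q2R : 2 <= q%:R :> R by rewrite ler_nat.
pose q' := floor_scaled i r.
have x'E : c * x = i%:R * c ^+ r by rewrite xE -{2}(prednK r0) exprS; lra.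
have /andP[qx' xq'] : q'%:R <= c * x < q'%:R + 1 by rewrite x'E floor_scaled_bounds.
case: (leqP q' 1) => q'1.
  (* The probe falls beyond the list. Then c x < 2 gives x < 3, hence q = 2: the remaining list is
     empty and costs nothing. *)
  have {}q2 : q = 2%N.
    apply/eqP; rewrite eqn_leq q2 andbT -ltnS -(ltr_nat R).
    have : q'%:R <= 1 :> R by rewrite lern1.
    have : 7 / 10 * x <= c * x by rewrite ler_wpM2r; lra.
    lra.
  subst q; rewrite q2 !big_ord_recr big_ord0 /= probe_costS.
  have -> : (i.-1 <= alpha_idx i r)%N by rewrite /alpha_idx -/q'; lia.
  have -> : (i.-2 - (i - 2) = 0)%N by lia.
  rewrite addn0 subnn rhbs_depth00 muln0 /=.
  have P0 : 0 <= 2 ^+ k :> R by rewrite exprn_ge0.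
  have x0 : 0 <= x by lra.
  have := tail_bound_ge R c (2 ^+ k) x d ltac:(by apply/andP) P0 x0.
  have Px : 2 ^+ k <= x by move: win; rewrite /depth_window; case: (d) => -[]; nra.
  have x3 : x <= 3 by move: xq; rewrite q2; lra.
  have : 0 <= k.+1%:R :> R by rewrite ler0n.
  have : 2 ^+ k * x <= x * 3 by rewrite mulrC ler_wpM2l //; lra.
  rewrite subnn mul0n !addn0; lra.
have q'2R : 2 <= q'%:R :> R by rewrite ler_nat.
have q'q : (q' <= q)%N by rewrite -ltnS -(ltr_nat R) -natr1; nra.
have qi : (q <= i)%N.
  have ci : c ^+ r.-1 <= 1 by rewrite exprn_ile1; lra.
  have : x <= i%:R by rewrite xE -[leRHS]mulr1 ler_wpM2l.
  by move=> xi; rewrite -(ler_nat R); lra.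
have seg : x * (1 - c) <= 2 ^+ k <= 2 * x * (1 - c).
  by move: win; rewrite /depth_window; case: (d) => -[]; nra.
rewrite probe_sum_step // !natrD sum_weights // -/q'.
have := segment_bound R c x k q q' c0 c2 ltac:(lra) ltac:(by apply/andP) ltac:(by apply/andP) seg.
(* With k = 0 the window would force x <= c / (1 - c) < 5 / 2, but a probe inside the list has c x
   >= 2. *)
have kd : (d <= k)%N.
  case: d win => //= -[w1 w2]; case: k w1 w2 {seg} => // w1 w2; rewrite expr0 in w1; nra.
have kdR : (k - d).+1%:R = k%:R - d%:R + 1 :> R by rewrite -natr1 natrB.
have P2 : 2 ^+ (k - d) = (if d then 2 ^+ k / 2 else 2 ^+ k) :> R.
  case: d kd {win kdR} => kd; last by rewrite subn0.
  by rewrite -[X in 2 ^+ X / 2](subnK kd) addn1 exprS; lra.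
have win' : depth_window R c (~~ d) (2 ^+ (k - d)) (c * x).
  rewrite P2; move: win; rewrite /depth_window; case: (d) => /= -[w1 w2]; split; nra.
have := IH r.+1 (k - d)%N (~~ d) (c * x) isT ltac:(clear - fr; lia) q'1 x'E win'.
rewrite kdR P2 /= -/q'.
set A := (\sum_(t < q') _)%N%:R; set B := (\sum_(t < q - q') _)%N%:R => hA hB.
rewrite -[k.+1%:R]natr1.
(* Each round adds one comparison. If [d] holds, the drop of k compensates for it on the suffix;
   otherwise the weight of the suffix remains as a surplus, which is the source of x^2 / 4 in
   [even_tail]. *)
have T' : q'%:R * (q'%:R - 1) / 2 <= x ^+ 2 / 4 by nra.
have xc : 100 * (c * x) + 3 * x <= 100 * x by nra.
move: hA hB; rewrite /tail_bound; case: (d) => /= hA hB; first by lra.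
by rewrite (even_tail_step R c _ x c2); lra.
Qed.

(* The decimal a.bbbcccddd.  A ring numeral is elaborated in unary, so numerals above a few
   thousand have to be avoided. *)
Notation dec9 a b c d := (a + b / 10 ^+ 3 + c / 10 ^+ 6 + d / 10 ^+ 9).

(** * Expected cost of one pair *)

Lemma rank_cost_sum_double_le (R : realType) (c : R) (m k k' : nat) (d : bool)
    (x := m.+2%:R : R) (P := 2 ^+ k : R) :
  0 < c -> c ^+ 2 = 1 / 2 -> (0 < m)%N -> use_2merge m.+2 ->
  (m.+2 <= 2 ^ k)%N -> (2 ^ k < m.+2.*2)%N ->
  depth_window R c d (2 ^+ k') x ->
  (rank_cost_sum m.+2)%:R <= x * (x - 1) * (k'%:R + k%:R + 3) +
    (2 * tail_bound R c d (2 ^+ k') x + 200 * x - 2 * P * (x - 1) + P ^+ 2 / 3).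
Proof.
move=> c0 c2 m0 use hi lo win.
have fl0 : floor_scaled m.+2 0 = m.+2.
  have := floor_scaledP m.+2 0; rewrite expn0 !muln1 => /andP[].
  by rewrite leq_exp2r // ltn_exp2r // => h1 h2; apply/eqP; rewrite eqn_leq h1 -ltnS.
have := probe_tail R c m.+2 (2 * m.+2).+1 1 k' d x c0 c2 isT ltac:(lia) _ _ win.
rewrite /= fl0 subnn => /(_ isT ltac:(by rewrite expr0 mulr1)).
have := ext_path_sum_le R k m.+1 ltac:(move: lo hi; case: (k) => [|k0]; rewrite ?expnS; lia)
    ltac:(lia) isT.
rewrite (rank_cost_sum_double m use).
have -> : (\sum_(a < m.+2) ((m.+1 - a) * (1 + probe_cost (2 * m.+2).+1 m.+2 1 0 a) + ext_path
    (m.+1 - a)) =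
   \sum_(a < m.+2) (m.+1 - a) + \sum_(a < m.+2) (m.+1 - a) * probe_cost (2 * m.+2).+1 m.+2 1 0 (0
       + a)
   + \sum_(t < m.+2) ext_path t)%N.
  rewrite [X in (_ = _ + X)%N](reindex_inj rev_ord_inj) /= -!big_split /=.
  by apply: eq_bigr => a _; rewrite mulnDr muln1 add0n subSS.
rewrite natrM !natrD.
have := sum_weights R m.+2 m.+2 (leqnn _); rewrite /= => ->.
set A := (\sum_(t < m.+2) ext_path t)%N%:R; set B := (\sum_(t < m.+2) _)%N%:R.
rewrite -/x -/P -[k'.+1%:R]natr1 -[k.+1%:R]natr1.
have -> : m.+1%:R = x - 1 :> R by rewrite /x -[m.+2%:R]natr1; lra.
lra.
Qed.

(** By 1 / (x - 1) <= 2 / x, the linear term and the replacement of x (x - 1) by x^2 cost at most 2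
    (204 + 20) / x. Here 204 will be 200 from the rounded probes plus 4 from 2 P <= 4 x. *)
Lemma average_bound (R : realType) (N Q x : R) : 2 <= x -> N <= Q + 204 * x -> Q <= 20 * x ^+ 2 ->
  N / (x * (x - 1)) <= Q / x ^+ 2 + 448 / x.
Proof.
move=> x2 NQ Qx; have x0 : 0 < x by lra.
rewrite ler_pdivrMr; last by rewrite mulr_gt0; lra.
have -> : (Q / x ^+ 2 + 448 / x) * (x * (x - 1)) = Q - Q / x + 448 * x - 448.
  by field; lra.
have : Q / x <= 20 * x by rewrite ler_pdivrMr // -mulrA -expr2.
lra.
Qed.

(** No error term arises: the exact average contains - P / (x - 1) - P / x, and the first summand is
    at most - P / x. *)
Lemma pair_average_single (R : realType) (m k : nat) (x := m.+2%:R : R) (P := 2 ^+ k : R) :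
  ~~ use_2merge m.+2 -> (0 < m)%N -> (m.+2 <= 2 ^ k)%N -> (2 ^ k < m.+2.*2)%N ->
  (rank_cost_sum m.+2)%:R / (m.+2 * m.+1)%:R <= 2 * k%:R + 2 - 2 * (P / x).
Proof.
move=> nu m0 hi lo; rewrite rank_cost_sum_single //.
have lo' : (2 ^ k <= m.+1.*2)%N by move: lo hi; case: (k) => [|k0]; rewrite ?expnS; lia.
have := ext_pathE k m.+1 lo' ltac:(lia); have := ext_pathE k m.+2 ltac:(lia) hi.
move=> /(congr1 (fun n => n%:R : R)) e2 /(congr1 (fun n => n%:R : R)) e1.
move: e1 e2; rewrite !natrD !natrM !natrX -/P -/x -[k.+1%:R]natr1.
have -> : m.+1%:R = x - 1 :> R by rewrite /x -[m.+2%:R]natr1; lra.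
have x3 : 3 <= x by rewrite /x ler_nat.
have P0 : 0 < P by rewrite exprn_gt0.
move=> e1 e2; rewrite ler_pdivrMr; last by rewrite mulr_gt0; lra.
have -> : (2 * k%:R + 2 - 2 * (P / x)) * (x * (x - 1)) = 
   (2 * k%:R + 2) * (x * (x - 1)) - 2 * P * (x - 1) by field; lra.
have -> : (ext_path m.+1)%:R = (k%:R + 1) * (x - 1) - P by lra.
have -> : (ext_path m.+2)%:R = (k%:R + 1) * x - P by lra.
nra.
Qed.

Lemma even_tailE (R : realType) (c P x : R) : c ^+ 2 = 1 / 2 ->
  even_tail R c P x = 4 / 3 * ((23 / 8 - 3 * c) * x ^+ 2 - (3 / 2 + c) * (P * x) + P ^+ 2).
Proof.
move=> c2; have c2x : c ^+ 2 * x ^+ 2 = x ^+ 2 / 2 by rewrite c2; lra.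
have c3x : c ^+ 3 * x ^+ 2 = c * x ^+ 2 / 2 by rewrite exprSr c2; lra.
have c2P : c ^+ 2 * (P * x) = P * x / 2 by rewrite c2; lra.
by rewrite /even_tail /sig; lra.
Qed.

(** For P / 2 < x <= P the first segment has length x (1 - c), between about 0.146 P and 0.293 P. It
    is compared with c P / 4 and P / 4, which gives this case and the next two; the cuts are at x =
    (2 c + 1) P / 4 and x = (1 + c) P / 2. *)
Lemma tail_bound_low (R : realType) (c P x : R) : c ^+ 2 = 1 / 2 ->
  tail_bound R c true (P / 4) x =
  (11 / 3 - 4 * c) * x ^+ 2 - 7 / 12 * (P * x) + 5 / 96 * P ^+ 2.
Proof.
move=> c2; have c2x : c ^+ 2 * x ^+ 2 = x ^+ 2 / 2 by rewrite c2; lra.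
have c3x : c ^+ 3 * x ^+ 2 = c * x ^+ 2 / 2 by rewrite exprSr c2; lra.
have c2P : c ^+ 2 * (P * x) = P * x / 2 by rewrite c2; lra.
by rewrite /tail_bound even_tailE // /sig; lra.
Qed.

Lemma tail_bound_mid (R : realType) (c P x : R) : c ^+ 2 = 1 / 2 ->
  tail_bound R c false (P / 4) x =
  (23 / 6 - 4 * c) * x ^+ 2 - (1 / 2 + c / 3) * (P * x) + 1 / 12 * P ^+ 2.
Proof. by move=> c2; rewrite /tail_bound even_tailE //; lra. Qed.

Lemma tail_bound_high (R : realType) (c P x : R) : c ^+ 2 = 1 / 2 ->
  tail_bound R c true (P / 2) x =
  (11 / 3 - 4 * c) * x ^+ 2 - 7 / 6 * (P * x) + 5 / 24 * P ^+ 2.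
Proof.
move=> c2; have c2x : c ^+ 2 * x ^+ 2 = x ^+ 2 / 2 by rewrite c2; lra.
have c3x : c ^+ 3 * x ^+ 2 = c * x ^+ 2 / 2 by rewrite exprSr c2; lra.
have c2P : c ^+ 2 * (P * x) = P * x / 2 by rewrite c2; lra.
by rewrite /tail_bound even_tailE // /sig; lra.
Qed.

Lemma average_bound_coef (R : realType) (S N x P k k' a b d : R) : 4 <= x ->
  S <= x * (x - 1) * (k' + k + 3) + N ->
  N <= (a - (k' + 3 - k)) * x ^+ 2 + b * (P * x) + d * P ^+ 2 + 204 * x ->
  (a - (k' + 3 - k)) * x ^+ 2 + b * (P * x) + d * P ^+ 2 <= 20 * x ^+ 2 ->
  S / (x * (x - 1)) <= 448 / x + 2 * k + (a + b * (P / x) + d * (P / x) ^+ 2).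
Proof.
move=> x4 h1 h2 h3; have xx : 0 < x * (x - 1) by rewrite mulr_gt0; lra.
have avg := average_bound R _ _ x ltac:(lra) h2 h3.
have e : ((a - (k' + 3 - k)) * x ^+ 2 + b * (P * x) + d * P ^+ 2) / x ^+ 2 =
    a - (k' + 3 - k) + b * (P / x) + d * (P / x) ^+ 2 by field; lra.
have : S / (x * (x - 1)) <= k' + k + 3 + N / (x * (x - 1)).
  rewrite ler_pdivrMr // mulrDl divfK; last by rewrite gt_eqF.
  by rewrite mulrC.
rewrite e in avg; clear - avg; lra.
Qed.

(** The constant terms are 25/3 - 8 c, 26/3 - 8 c and 28/3 - 8 c rounded up; the decimal coefficient
    of - u is 3 + 2 c / 3 rounded down. *)
Lemma pair_average_double (R : realType) (c : R) (m k : nat) (x := m.+2%:R : R) (P := 2 ^+ k : R)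
    (u := P / x) :
  (dec9 0 707 106 781 + 1 / 10 ^+ 10) < c < (dec9 0 707 106 781 + 2 / 10 ^+ 10) -> c ^+ 2 = 1 / 2 ->
  (1 < m)%N -> use_2merge m.+2 ->
  (m.+2 <= 2 ^ k)%N -> (2 ^ k < m.+2.*2)%N ->
  (rank_cost_sum m.+2)%:R / (m.+2 * m.+1)%:R <= 448 / x + 2 * k%:R +
   if 4 * x <= P * (2 * c + 1) then dec9 2 676 479 90 - 19 / 6 * u + 7 / 16 * u ^+ 2
   else if 2 * x <= P * (1 + c) then
     dec9 3 9 812 420 - dec9 3 471 404 520 * u + 1 / 2 * u ^+ 2
   else dec9 3 676 479 90 - 13 / 3 * u + 3 / 4 * u ^+ 2.
Proof.
move=> /andP[cl ch] c2 m1 use hi lo.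
have m0 : (0 < m)%N by lia.
have c0 : 0 < c by lra.
have bound := rank_cost_sum_double_le R c m k _ _ c0 c2 m0 use hi lo.
have x4 : 4 <= x by rewrite /x ler_nat.
have hiR : x <= P by rewrite /P -natrX ler_nat.
have loR : P <= 2 * x by rewrite /P -natrX -natrM ler_nat mul2n ltnW.
have k2 : (2 <= k)%N.
  by clear - hi m1; move: hi; case: (k) => [|[|k0]] //; rewrite ?expn0 ?expn1; lia.
have kE : k%:R = (k - 2)%:R + 2 :> R by rewrite (natrB _ k2); lra.
have kE' : k%:R = (k - 1)%:R + 1 :> R by rewrite (natrB _ (ltnW k2)); lra.
have P4 : 2 ^+ (k - 2) = P / 4 :> R by rewrite /P -[in RHS](subnK k2) exprD; lra.
have P2 : 2 ^+ (k - 1) = P / 2 :> R by rewrite /P -[in RHS](subnK (ltnW k2)) exprD; lra.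
have Px : P * x <= 2 * x ^+ 2 by rewrite expr2 mulrA ler_wpM2r //; lra.
have PP : P ^+ 2 <= 4 * x ^+ 2 by nra.
have x20 : 0 <= x ^+ 2 by rewrite exprn_ge0 //; lra.
have Px0 : 0 <= P * x by apply: mulr_ge0; clear - hiR x4; lra.
have l1 : 0 <= (c - (dec9 0 707 106 781 + 1 / 10 ^+ 10)) * x ^+ 2
  by apply: mulr_ge0 => //; clear - cl ch; lra.
have l3 : 0 <= (c - (dec9 0 707 106 781 + 1 / 10 ^+ 10)) * (P * x)
  by apply: mulr_ge0 => //; clear - cl ch; lra.
rewrite natrM -/x; have -> : m.+1%:R = x - 1 :> R by rewrite /x -[m.+2%:R]natr1 addrK.
have small (a b d : R) : a <= 4 -> b <= 0 -> d <= 1 -> 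
    a * x ^+ 2 + b * (P * x) + d * P ^+ 2 <= 20 * x ^+ 2.
  move=> a4 b0 d1; have h1 : a * x ^+ 2 <= 4 * x ^+ 2 by apply: ler_wpM2r.
  have h2 : b * (P * x) <= 0 by apply: mulr_le0_ge0.
  have h3 : d * P ^+ 2 <= 1 * P ^+ 2 by apply: ler_wpM2r => //; apply: exprn_ge0; apply: le_trans
      hiR; apply: ler0n.
  clear - h1 h2 h3 PP x20; lra.
have P0 : 0 <= P by apply: le_trans hiR; apply: ler0n.
have e2 : (k - 2)%:R + 3 - k%:R = 1 :> R by clear - kE; lra.
have e1 : (k - 1)%:R + 3 - k%:R = 2 :> R by clear - kE'; lra.
case: ifP => C1.
  have win : depth_window R c true (2 ^+ (k - 2)) x.
    rewrite P4 /=; clear - C1 cl ch loR c2 x4; split; nra.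
  have := average_bound_coef R _ _ x P k%:R (k - 2)%:R (dec9 2 676 479 90) (- (19 / 6))
     (7 / 16) x4 (bound _ _ win).
  rewrite P4 e2 tail_bound_low // => h; rewrite -mulNr; apply: h.
    rewrite -/x -/P; clear - l1 loR x20; lra.
  by apply: small; clear; lra.
case: ifP => C2.
  have win : depth_window R c false (2 ^+ (k - 2)) x.
    rewrite P4 /=; clear - C1 C2 cl ch hiR c2 x4; split; nra.
  have := average_bound_coef R _ _ x P k%:R (k - 2)%:R (dec9 3 9 812 420)
     (- (dec9 3 471 404 520)) (1 / 2) x4 (bound _ _ win).
  rewrite P4 e2 tail_bound_mid // => h; rewrite -mulNr; apply: h.
    rewrite -/x -/P; clear - l1 l3 loR x20 Px0; lra.
  by apply: small; clear; lra.
have win : depth_window R c true (2 ^+ (k - 1)) x.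
  rewrite P2 /=; clear - C1 C2 cl ch hiR c2 x4; split; nra.
have := average_bound_coef R _ _ x P k%:R (k - 1)%:R (dec9 3 676 479 90)
   (- (13 / 3)) (3 / 4) x4 (bound _ _ win).
rewrite P2 e1 tail_bound_high // => h; rewrite -mulNr; apply: h.
  rewrite -/x -/P; clear - l1 loR x20; lra.
by apply: small; clear; lra.
Qed.

(** * Logarithms *)

Lemma nondecr_of_derive (R : realType) (f df : R -> R) (a b : R) : a <= b ->
  (forall x, a <= x <= b -> is_derive x (1 : R) f (df x)) ->
  (forall x, a <= x <= b -> 0 <= df x) -> f a <= f b.
Proof.
move=> ab fd df0.
have [c cab fE] : exists2 c, c \in `[a, b]%R & f b - f a = df c * (b - a).
  apply: MVT_segment => // x.
    by rewrite in_itv /= => /andP[ax xb]; apply: fd; rewrite !ltW.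
  apply: derivable_within_continuous => y; rewrite in_itv /= => yab.
  by have [] := fd y yab.
rewrite -subr_ge0 fE mulr_ge0 ?subr_ge0 // df0 //; by rewrite in_itv in cab.
Qed.

Lemma is_derive_inv (R : realType) (x : R) : x != 0 ->
  is_derive x (1 : R) (fun y : R => y^-1) (- x ^- 2).
Proof.
move=> x0; have dx : derivable (@id R) x 1 by [].
have := DeriveDef (derivableV x0 dx) (deriveV x0 dx).
by rewrite (@derive_val _ _ _ _ _ _ _ (is_derive_id x (1 : R))) [_ *: _]mulr1.
Qed.

(** On each piece the difference of the two sides of the final inequality belongs to this family, up
    to an additive constant. *)
Lemma is_derive_entropy (R : realType) (a b g d x : R) : 0 < x ->
  is_derive x (1 : R) (fun y : R => a * y + b * ln y + g * (y * ln y) + d / y)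
    (a + b / x + g * (ln x + 1) - d / x ^+ 2).
Proof.
move=> x0; have dl := is_derive1_ln x0.
have dv := is_derive_inv R x (lt0r_neq0 x0).
have d1 : is_derive x (1 : R) (a *: (id : R -> R)) (a *: 1) by apply: is_deriveZ.
have d2 : is_derive x (1 : R) (b *: (@ln R)) (b *: x^-1) by apply: is_deriveZ.
have d3 : is_derive x (1 : R) (g *: ((id : R -> R) * (@ln R))) (g *: (x *: x^-1 + ln x *: 1)).
  by apply: is_deriveZ.
have d4 : is_derive x (1 : R) (d *: (fun y : R => y^-1)) (d *: (- x ^- 2)) by apply: is_deriveZ.
apply: (is_derive_eq (is_deriveD (is_deriveD (is_deriveD d1 d2) d3) d4)).
rewrite /GRing.scale /= !mulr1 divff ?lt0r_neq0 // mulrN.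
by rewrite [1 + _]addrC.
Qed.

Lemma entropy_nondecr (R : realType) (a b g d l r x y : R) : 0 < l -> l <= x -> x <= y -> y <= r ->
  (forall p, l <= p <= r -> 0 <= a + b / p + g * (ln p + 1) - d / p ^+ 2) ->
  a * x + b * ln x + g * (x * ln x) + d / x <= a * y + b * ln y + g * (y * ln y) + d / y.
Proof.
move=> l0 lx xy yr pos.
apply: (nondecr_of_derive R (fun y => a * y + b * ln y + g * (y * ln y) + d / y) _ x y xy).
  by move=> p /andP[xp py]; apply: is_derive_entropy; lra.
by move=> p /andP[xp py]; apply: pos; lra.
Qed.

(** The series of 2 artanh t. Since 1 / 8 = (1 / 9) / (1 - 1 / 9), the term t^9 / 8 is the geometric
    bound for the remainder when t^2 <= 1 / 9. *)
Lemma ln_series (R : realType) (t : R) : 0 <= t <= 1 / 3 ->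
  2 * (t + t ^+ 3 / 3 + t ^+ 5 / 5 + t ^+ 7 / 7) <= ln ((1 + t) / (1 - t)) /\
  ln ((1 + t) / (1 - t)) <= 2 * (t + t ^+ 3 / 3 + t ^+ 5 / 5 + t ^+ 7 / 7 + t ^+ 9 / 8).
Proof.
move=> /andP[t0 t1].
have -> : ln ((1 + t) / (1 - t)) = ln (1 + t) - ln (1 - t) :> R.
  by rewrite ln_div ?posrE; lra.
pose F (d : R) : R -> R := ((@ln R) \o (cst 1 + id)) - ((@ln R) \o (cst 1 - id))
   - 2 *: (id + 3^-1 *: id ^+ 3 + 5^-1 *: id ^+ 5 + 7^-1 *: id ^+ 7 + d *: id ^+ 9).
pose F' (d x : R) := (1 + x)^-1 + (1 - x)^-1
   - 2 * (1 + x ^+ 2 + x ^+ 4 + x ^+ 6 + 9 * d * x ^+ 8).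
have FE d x : F d x = ln (1 + x) - ln (1 - x)
   - 2 * (x + 3^-1 * x ^+ 3 + 5^-1 * x ^+ 5 + 7^-1 * x ^+ 7 + d * x ^+ 9).
  by rewrite /F /=; congr (_ - 2 * (_ + _ * _ + _ * _ + _ * _ + _ * _)); rewrite exprfctE.
have dF d x : 0 <= x <= t -> is_derive x (1 : R) (F d) (F' d x).
  move=> /andP[x0 xt].
  have h1 : is_derive (1 + x) (1 : R) (@ln R) (1 + x)^-1 by apply: is_derive1_ln; lra.
  have h2 : is_derive (1 - x) (1 : R) (@ln R) (1 - x)^-1 by apply: is_derive1_ln; lra.
  have g1 : is_derive x (1 : R) ((@ln R) \o (cst 1 + id)) ((1 + x)^-1 * (0 + 1)).
    exact: is_derive1_comp.
  have g2 : is_derive x (1 : R) ((@ln R) \o (cst 1 - id)) ((1 - x)^-1 * (0 - 1)).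
    exact: is_derive1_comp.
  have dX n (k : R) : is_derive x (1 : R) (k *: (id : R -> R) ^+ n.+1) (k *: ((n.+1%:R * x ^+ n)
      *: 1)).
    exact: is_deriveZ.
  have := is_deriveD (is_deriveD (is_deriveD (is_deriveD (is_derive_id x (1 : R))
     (dX 2%N 3^-1)) (dX 4%N 5^-1)) (dX 6%N 7^-1)) (dX 8%N d).
  move=> /(is_deriveZ 2) dp; apply: (is_derive_eq (is_deriveB (is_deriveB g1 g2) dp)).
  by rewrite /GRing.scale /F' /=; field; lra.
have F0 d : F d 0 = 0.
  by rewrite FE addr0 subr0 ln1 !expr0n /=; lra.
have inv x : 0 <= x <= t -> (1 + x)^-1 + (1 - x)^-1 = 2 / (1 - x ^+ 2) :> R.
  by move=> /andP[x0 xt]; field; rewrite !lt0r_neq0 //; nra.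
split.
  have : F 0 0 <= F 0 t.
    apply: (nondecr_of_derive R (F 0) (F' 0) 0 t t0 (dF 0)) => x xt.
    have /andP[x0 xt1] := xt.
    rewrite /F' inv // subr_ge0 ler_pdivlMr; last by nra.
    have := exprn_ge0 8 x0; lra.
  by rewrite F0 FE; lra.
have : - F (1 / 8) 0 <= - F (1 / 8) t.
  apply: (nondecr_of_derive R (- F (1 / 8)) (fun x => - F' (1 / 8) x) 0 t t0) => x xt.
    exact: is_deriveN (dF _ _ xt).
  have /andP[x0 xt1] := xt.
  rewrite /F' inv // oppr_ge0 subr_le0 ler_pdivrMr; last by nra.
  have x2 : 0 <= 1 / 9 - x ^+ 2 by nra.
  have := mulr_ge0 (exprn_ge0 8 x0) x2; lra.
by rewrite F0 FE; lra.
Qed.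

Lemma ln_upper (R : realType) (t y v : R) : 0 <= t <= 1 / 3 -> 0 < y -> y * (1 - t) <= 1 + t ->
  2 * (t + t ^+ 3 / 3 + t ^+ 5 / 5 + t ^+ 7 / 7 + t ^+ 9 / 8) <= v -> ln y <= v.
Proof.
move=> /andP[t0 t1] y0 yt; apply: le_trans.
have [_] := ln_series R t ltac:(by apply/andP); apply: le_trans.
rewrite ler_ln ?posrE //; last by rewrite divr_gt0; lra.
by rewrite ler_pdivlMr //; lra.
Qed.

Lemma ln_lower (R : realType) (t y v : R) : 0 <= t <= 1 / 3 -> 1 + t <= y * (1 - t) ->
  v <= 2 * (t + t ^+ 3 / 3 + t ^+ 5 / 5 + t ^+ 7 / 7) -> v <= ln y.
Proof.
move=> /andP[t0 t1] yt /le_trans; apply.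
have [h _] := ln_series R t ltac:(by apply/andP); apply: le_trans h _.
rewrite ler_ln ?posrE; first by rewrite ler_pdivrMr //; lra.
  by rewrite divr_gt0; lra.
by nra.
Qed.

Lemma ln2_bounds (R : realType) : dec9 0 693 147 178 <= ln (2 : R) <= dec9 0 693 147 182.
Proof.
(* The factorization 2 = (5/4)^3 (128/125) makes both arguments of the series small, namely 1/9 and
   3/253. *)
have -> : ln (2 : R) = ln (5 / 4) *+ 3 + ln (128 / 125).
  rewrite -lnXn; last by lra.
  by rewrite -lnM ?posrE; [congr ln; lra|lra|lra].
have := ln_lower R (1 / 9) (5 / 4) _ ltac:(apply/andP; split; lra) ltac:(lra) (lexx _).
have := ln_upper R (1 / 9) (5 / 4) _ ltac:(apply/andP; split; lra) ltac:(lra) ltac:(lra) (lexx _).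
have := ln_lower R (3 / 253) (128 / 125) _ ltac:(apply/andP; split; lra) ltac:(lra) (lexx _).
have := ln_upper R (3 / 253) (128 / 125) _ ltac:(apply/andP; split; lra) ltac:(lra) ltac:(lra)
    (lexx _).
by rewrite -mulr_natl => *; apply/andP; split; lra.
Qed.

Lemma ln_scale2 (R : realType) (y : R) : 0 < y -> ln y = ln (2 * y) - ln 2.
Proof. by move=> y0; rewrite lnM ?posrE //; lra. Qed.

Lemma ln_inv_opp (R : realType) (y : R) : 0 < y -> ln y = - ln y^-1.
Proof. by move=> y0; rewrite lnV ?posrE // opprK. Qed.

(** Here and in the next bounds the decimal argument of the series is (y - 1) / (y + 1), rounded up
    for upper and down for lower bounds, after y has been moved above 1 by doubling or inversion. *)
Lemma ln_b1 (R : realType) : ln (dec9 0 551 100 0 : R) + ln 2 <= dec9 0 97 308 183.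
Proof.
rewrite (ln_scale2 R (dec9 0 551 100 0)) ?subrK; last by lra.
by apply: (ln_upper R (dec9 0 48 615 736)); [apply/andP; split| | |]; lra.
Qed.

Lemma ln_b2 (R : realType) (b : R) : 0 < b -> 2 * b <= dec9 1 207 106 782 -> ln b + ln 2 <= dec9
    0 188 226 408.
Proof.
move=> b0 b2; rewrite (ln_scale2 R b) ?subrK //.
by apply: (ln_upper R (dec9 0 93 836 322)); [apply/andP; split| | |]; lra.
Qed.

Lemma ln_b3 (R : realType) (b : R) : 0 < b -> b <= dec9 0 853 553 391 -> ln b <= - dec9 0 158 347
    182.
Proof.
move=> b0 b3; rewrite (ln_inv_opp R b) // lerN2.
apply: (ln_lower R (dec9 0 79 8 573)); [apply/andP; split; lra| |lra].
rewrite [_^-1 * _]mulrC ler_pdivlMr //; lra.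
Qed.

Lemma ln_b4 (R : realType) : - dec9 0 118 783 537 <= ln (dec9 0 888 0 0 : R).
Proof.
rewrite ln_inv_opp ?lerN2; last by lra.
apply: (ln_upper R (dec9 0 59 322 34)); [apply/andP; split; lra|rewrite invr_gt0; lra| |lra].
rewrite [_^-1 * _]mulrC ler_pdivrMr; lra.
Qed.

Lemma ln_p0 (R : realType) : - dec9 0 107 245 626 <= ln (dec9 0 898 305 0 : R) <= - dec9 0 107
    245 623.
Proof.
rewrite ln_inv_opp ?lerN2; last by lra.
apply/andP; split.
  apply: (ln_upper R (dec9 0 53 571 476)); [apply/andP; split; lra|rewrite invr_gt0; lra| |lra].
  rewrite [_^-1 * _]mulrC ler_pdivrMr; lra.
apply: (ln_lower R (dec9 0 53 571 475)); [apply/andP; split; lra| |lra].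
rewrite [_^-1 * _]mulrC ler_pdivlMr; lra.
Qed.

(** The points of tangency for the range of 2Merge, each inside the interval on which its tangent
    replaces ln. *)
Lemma ln_tangents (R : realType) :
  [/\ ln (58 / 100 : R) <= - dec9 0 544 720 0,
      ln (63 / 100 : R) <= - dec9 0 462 30 0,
      ln (71 / 100 : R) <= - dec9 0 342 480 0 &
  [/\ ln (79 / 100 : R) <= - dec9 0 235 720 0,
      ln (845 / 1000 : R) <= - dec9 0 168 410 0 &
      ln (87 / 100 : R) <= - dec9 0 139 260 0]].
Proof.
have /andP[l2 _] := ln2_bounds R.
split.
- rewrite ln_scale2; last by lra.
  have := ln_upper R (2 / 27) (2 * (58 / 100)) (dec9 0 148 420 10) ltac:(apply/andP; split; lra);
      lra.
- rewrite ln_scale2; last by lra.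
  have := ln_upper R (13 / 113) (2 * (63 / 100)) (dec9 0 231 111 730) ltac:(apply/andP; split;
      lra); lra.
- rewrite ln_scale2; last by lra.
  have := ln_upper R (21 / 121) (2 * (71 / 100)) (dec9 0 350 656 900) ltac:(apply/andP; split;
      lra); lra.
split.
- rewrite ln_inv_opp ?lerN2; last by lra.
  by apply: (ln_lower R (21 / 179)); [apply/andP; split| |]; lra.
- rewrite ln_inv_opp ?lerN2; last by lra.
  by apply: (ln_lower R (31 / 369)); [apply/andP; split| |]; lra.
- rewrite ln_inv_opp ?lerN2; last by lra.
  by apply: (ln_lower R (13 / 187)); [apply/andP; split| |]; lra.
Qed.

(** * Integrating the cost over one octave *)

Definition prim (R : realType) (a b d p : R) : R := a * p + b * ln p - d / p.

Definition clamp (R : realType) (l r p : R) : R := if p <= l then l else if p <= r then p else r.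

(* The integral of a + b / t + d / t^2 over the part of [l, r] below [p]. *)
Definition seg (R : realType) (a b d l r p : R) : R :=
  prim R a b d (clamp R l r p) - prim R a b d l.

Lemma ln_diff_le (R : realType) (x y : R) : 0 < x -> 0 < y -> ln y - ln x <= (y - x) / x.
Proof.
move=> x0 y0; rewrite -ln_div ?posrE //.
have -> : y / x = 1 + (y - x) / x by field; lra.
apply: le_ln1Dx; rewrite ltr_pdivlMr //; lra.
Qed.

(** The integrand is at least b / t >= - 10 for t >= 1/2. A one-sided bound suffices, since a step
    across a breakpoint only needs the integral not to fall too much. *)
Lemma prim_lip (R : realType) (a b d x y : R) : 1 / 2 <= x -> x <= y -> 0 <= a -> -5 <= b <= 0 ->
    0 <= d ->
  - (10 * (y - x)) <= prim R a b d y - prim R a b d x.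
Proof.
move=> x2 xy a0 /andP[b5 b0] d0; rewrite /prim.
have ln1 := ln_diff_le R x y ltac:(lra) ltac:(lra).
have h1 : (y - x) / x <= 2 * (y - x) by rewrite ler_pdivrMr; nra.
have h2 : d / y <= d / x by rewrite ler_wpM2l // lef_pV2 ?posrE; lra.
have h3 : 0 <= a * (y - x) by apply: mulr_ge0; lra.
have h4 : 0 <= (0 - b) * (2 * (y - x) - (ln y - ln x)) by apply: mulr_ge0; lra.
have h5 : 0 <= (b + 5) * (y - x) by apply: mulr_ge0; lra.
clear - h2 h3 h4 h5; lra.
Qed.

(** A rectangle rule at the right end, where the cost of a pair is evaluated. The constant 20 comes
    from - b <= 5 and 1 / (x y) <= 4; the error of the term with d has the favourable sign. *)
Lemma prim_step (R : realType) (a b d x y : R) : 1 / 2 <= x -> x <= y -> -5 <= b <= 0 -> 0 <= d ->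
  (y - x) * (a + b / y + d / y ^+ 2) - 20 * (y - x) ^+ 2 <= prim R a b d y - prim R a b d x.
Proof.
move=> x2 xy /andP[b5 b0] d0; rewrite /prim.
have x0 : 0 < x by lra. have y0 : 0 < y by lra.
have ln1 := ln_diff_le R x y x0 y0.
have e1 : (y - x) / x = (y - x) / y + (y - x) ^+ 2 / (x * y) by field; lra.
have h1 : (y - x) ^+ 2 / (x * y) <= 4 * (y - x) ^+ 2.
  rewrite ler_pdivrMr; last by rewrite mulr_gt0.
  have : 1 <= 4 * (x * y) by nra.
  have := sqr_ge0 (y - x); nra.
have h2 : 0 <= (0 - b) * ((y - x) / x - (ln y - ln x)) by apply: mulr_ge0; lra.
have h3 : 0 <= (0 - b) * (4 * (y - x) ^+ 2 - (y - x) ^+ 2 / (x * y)) by apply: mulr_ge0; lra.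
have h4 : 0 <= (b + 5) * (4 * (y - x) ^+ 2).
  by apply: mulr_ge0; [lra|apply: mulr_ge0; [lra|apply: sqr_ge0]].
have e2 : d / x - d / y = d * (y - x) / (x * y) by field; lra.
have h5 : d * (y - x) / y ^+ 2 <= d * (y - x) / (x * y).
  apply: ler_wpM2l; first by apply: mulr_ge0; lra.
  rewrite lef_pV2 ?posrE ?expr2; first by apply: ler_wpM2r; lra.
    by rewrite mulr_gt0.
  by rewrite mulr_gt0.
have e3 : (y - x) * (a + b / y + d / y ^+ 2) = a * (y - x) + b * ((y - x) / y) + d * (y - x) / y
    ^+ 2.
  by field; lra.
rewrite e3; clear - e1 h2 h3 h4 e2 h5; rewrite e1 in h2; lra.
Qed.

Lemma seg_in (R : realType) (a b d l r x y : R) : l <= x -> x <= y -> y <= r ->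
  seg R a b d l r y - seg R a b d l r x = prim R a b d y - prim R a b d x.
Proof.
move=> lx xy yr.
have cl z : l <= z -> z <= r -> clamp R l r z = z.
  move=> lz zr; rewrite /clamp zr; case: ifP => // zl.
  by apply: le_anti; rewrite lz zl.
by rewrite /seg !cl //; lra.
Qed.

Lemma seg_lo (R : realType) (a b d l r x : R) : x <= l -> seg R a b d l r x = 0.
Proof. by move=> xl; rewrite /seg /clamp xl subrr. Qed.

Lemma seg_hi (R : realType) (a b d l r x : R) : l <= r -> r <= x ->
  seg R a b d l r x = prim R a b d r - prim R a b d l.
Proof.
move=> lr rx; rewrite /seg /clamp; case: ifP => [xl|_].
  by have -> : l = r by lra.
by case: ifP => // xr; have -> : x = r by lra.
Qed.

Lemma seg_lip (R : realType) (a b d l r x y : R) : 1 / 2 <= l -> l <= r -> x <= y ->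
  0 <= a -> -5 <= b <= 0 -> 0 <= d ->
  - (10 * (y - x)) <= seg R a b d l r y - seg R a b d l r x.
Proof.
move=> l2 lr xy a0 bb d0.
have cx : l <= clamp R l r x by rewrite /clamp; case: ifP => // ?; case: ifP => // ?; lra.
have cxy : clamp R l r x <= clamp R l r y /\ clamp R l r y - clamp R l r x <= y - x.
  rewrite /clamp; clear - lr xy.
  case: (lerP x l) => h1; case: (lerP y l) => h2; case: (lerP x r) => h3; case: (lerP y r) => h4;
    by split; lra.
have := prim_lip R a b d (clamp R l r x) (clamp R l r y) ltac:(lra) ltac:(lra) a0 bb d0.
rewrite /seg; lra.
Qed.

Definition b1 {R : realType} : R := dec9 0 551 100 0.
Definition b2 {R : realType} (c : R) : R := (2 * c + 1) / 4.
Definition b3 {R : realType} (c : R) : R := (1 + c) / 2.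
Definition b4 {R : realType} : R := dec9 0 888 0 0.

(* At p = b2 c or p = b3 c the segments of even or odd index have a power of two as length; b1 and
   b4 are the paper's thresholds 0.5511 and 0.888 between 1Merge and 2Merge. *)
Definition is_half_sqrt2 {R : realType} (c : R) : Prop :=
  (dec9 0 707 106 781 + 1 / 10 ^+ 10) < c < (dec9 0 707 106 781 + 2 / 10 ^+ 10) /\ c ^+ 2 = 1 / 2.

(* For n = p 2^k, inserting a pair costs 2 k + rate p + O(1 / n). *)
Definition rate (R : realType) (c p : R) : R :=
  if p < b1 then 2 + - 2 / p + 0 / p ^+ 2
  else if p <= b2 c then dec9 2 676 479 90 + - (19 / 6) / p + 7 / 16 / p ^+ 2
  else if p <= b3 c then dec9 3 9 812 420 + - (dec9 3 471 404 520) / p + 1 / 2 / p ^+ 2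
  else if p <= b4 then dec9 3 676 479 90 + - (13 / 3) / p + 3 / 4 / p ^+ 2
  else 2 + - 2 / p + 0 / p ^+ 2.

(* The integral of [rate] from 1 / 2 to [p]. *)
Definition acc (R : realType) (c p : R) : R :=
  seg R 2 (- 2) 0 (1 / 2) b1 p
  + seg R (dec9 2 676 479 90) (- (19 / 6)) (7 / 16) b1 (b2 c) p
  + seg R (dec9 3 9 812 420) (- (dec9 3 471 404 520)) (1 / 2) (b2 c) (b3 c) p
  + seg R (dec9 3 676 479 90) (- (13 / 3)) (3 / 4) (b3 c) b4 p
  + seg R 2 (- 2) 0 b4 1 p.

Lemma breakpoints (R : realType) (c : R) : is_half_sqrt2 c ->
  [/\ 1 / 2 <= b1 :> R, b1 <= b2 c, b2 c <= b3 c, b3 c <= b4 & b4 <= 1 :> R].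
Proof. by move=> [/andP[c1 c2] _]; rewrite /b1 /b2 /b3 /b4; clear - c1 c2; split; lra. Qed.

Lemma acc_lip (R : realType) (c x y : R) : is_half_sqrt2 c -> x <= y ->
  - (50 * (y - x)) <= acc R c y - acc R c x.
Proof.
move=> /breakpoints[h1 h2 h3 h4 h5] xy; rewrite /acc.
have s1 := seg_lip R 2 (- 2) 0 (1 / 2) b1 x y ltac:(clear; lra) h1 xy
  ltac:(clear; lra) ltac:(clear; lra) ltac:(clear; lra).
have s2 := seg_lip R (dec9 2 676 479 90) (- (19 / 6)) (7 / 16) b1 (b2 c) x y h1 h2 xy
  ltac:(clear; lra) ltac:(clear; lra) ltac:(clear; lra).
have s3 := seg_lip R (dec9 3 9 812 420) (- (dec9 3 471 404 520)) (1 / 2) (b2 c) (b3 c) x y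
  ltac:(clear - h1 h2; lra) h3 xy ltac:(clear; lra) ltac:(clear; lra) ltac:(clear; lra).
have s4 := seg_lip R (dec9 3 676 479 90) (- (13 / 3)) (3 / 4) (b3 c) b4 x y
  ltac:(clear - h1 h2 h3; lra) h4 xy ltac:(clear; lra) ltac:(clear; lra) ltac:(clear; lra).
have s5 := seg_lip R 2 (- 2) 0 b4 1 x y
  ltac:(clear - h1 h2 h3 h4; lra) h5 xy ltac:(clear; lra) ltac:(clear; lra) ltac:(clear; lra).
clear - s1 s2 s3 s4 s5; lra.
Qed.

Lemma acc1 (R : realType) (c x y : R) : is_half_sqrt2 c -> 1 / 2 <= x -> x <= y -> y <= b1 ->
  acc R c y - acc R c x = prim R 2 (- 2) 0 y - prim R 2 (- 2) 0 x.
Proof.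
move=> /breakpoints[h1 h2 h3 h4 h5] lx xy yr.
rewrite -(seg_in R 2 (- 2) 0 (1 / 2) b1 x y lx xy yr) /acc.
by rewrite !(seg_lo R _ _ _ b1) ?(seg_lo R _ _ _ (b2 c)) ?(seg_lo R _ _ _ (b3 c)) ?(seg_lo R _ _
    _ b4) //;
  clear - h1 h2 h3 h4 h5 lx xy yr; lra.
Qed.

Lemma acc2 (R : realType) (c x y : R) : is_half_sqrt2 c -> b1 <= x -> x <= y -> y <= b2 c ->
  acc R c y - acc R c x = prim R (dec9 2 676 479 90) (- (19 / 6)) (7 / 16) y
    - prim R (dec9 2 676 479 90) (- (19 / 6)) (7 / 16) x.
Proof.
move=> /breakpoints[h1 h2 h3 h4 h5] lx xy yr.
rewrite -(seg_in R _ (- (19 / 6)) (7 / 16) b1 (b2 c) x y lx xy yr) /acc.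
by rewrite !(seg_hi R _ _ _ (1 / 2)) ?(seg_lo R _ _ _ (b2 c)) ?(seg_lo R _ _ _ (b3 c)) ?(seg_lo R
    _ _ _ b4) //;
  clear - h1 h2 h3 h4 h5 lx xy yr; lra.
Qed.

Lemma acc3 (R : realType) (c x y : R) : is_half_sqrt2 c -> b2 c <= x -> x <= y -> y <= b3 c ->
  acc R c y - acc R c x = prim R (dec9 3 9 812 420) (- (dec9 3 471 404 520)) (1 / 2) y
    - prim R (dec9 3 9 812 420) (- (dec9 3 471 404 520)) (1 / 2) x.
Proof.
move=> /breakpoints[h1 h2 h3 h4 h5] lx xy yr.
rewrite -(seg_in R _ (- (dec9 3 471 404 520)) (1 / 2) (b2 c) (b3 c) x y lx xy yr) /acc.
by rewrite !(seg_hi R _ _ _ (1 / 2)) ?(seg_hi R _ _ _ b1) ?(seg_lo R _ _ _ (b3 c)) ?(seg_lo R _ _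
    _ b4) //;
  clear - h1 h2 h3 h4 h5 lx xy yr; lra.
Qed.

Lemma acc4 (R : realType) (c x y : R) : is_half_sqrt2 c -> b3 c <= x -> x <= y -> y <= b4 ->
  acc R c y - acc R c x = prim R (dec9 3 676 479 90) (- (13 / 3)) (3 / 4) y
    - prim R (dec9 3 676 479 90) (- (13 / 3)) (3 / 4) x.
Proof.
move=> /breakpoints[h1 h2 h3 h4 h5] lx xy yr.
rewrite -(seg_in R _ (- (13 / 3)) (3 / 4) (b3 c) b4 x y lx xy yr) /acc.
by rewrite !(seg_hi R _ _ _ (1 / 2)) ?(seg_hi R _ _ _ b1) ?(seg_hi R _ _ _ (b2 c)) ?(seg_lo R _ _
    _ b4) //;
  clear - h1 h2 h3 h4 h5 lx xy yr; lra.
Qed.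

Lemma acc5 (R : realType) (c x y : R) : is_half_sqrt2 c -> b4 <= x -> x <= y -> y <= 1 ->
  acc R c y - acc R c x = prim R 2 (- 2) 0 y - prim R 2 (- 2) 0 x.
Proof.
move=> /breakpoints[h1 h2 h3 h4 h5] lx xy yr.
rewrite -(seg_in R 2 (- 2) 0 b4 1 x y lx xy yr) /acc.
by rewrite !(seg_hi R _ _ _ (1 / 2)) ?(seg_hi R _ _ _ b1) ?(seg_hi R _ _ _ (b2 c)) ?(seg_hi R _ _
    _ (b3 c)) //;
  clear - h1 h2 h3 h4 h5 lx xy yr; lra.
Qed.

(** * Summation over pairs by a potential function *)

Lemma use_2mergeE (R : realType) (m k : nat) (p := m%:R / 2 ^+ k : R) :
  (m <= 2 ^ k)%N -> (2 ^ k < m.*2)%N -> use_2merge m = (b1 <= p) && (p <= b4).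
Proof.
move=> hi lo; rewrite /use_2merge (up_log_itv k m) //.
have P0 : 0 < 2 ^+ k :> R by rewrite exprn_gt0.
rewrite -!(ler_nat R) !natrM natrX /p ler_pdivlMr // ler_pdivrMr // /b1 /b4.
by congr andb; apply/idP/idP; clear; lra.
Qed.

(** Counts the breakpoints passed. The mixture of weak and strict inequalities matches the cases of
    [rate], so equal counts place two points in the same case. *)
Definition passed (R : realType) (c p : R) : nat :=
  ((b1 <= p)%R + (b2 c < p)%R + (b3 c < p)%R + (b4 < p)%R)%N.

Lemma rate_le (R : realType) (c p : R) : 1 / 2 <= p -> rate R c p <= 7.
Proof.
move=> p2; have p0 : 0 < p by lra.
have i0 : 0 <= p^-1 by rewrite invr_ge0 ltW.
have h b : 0 <= b -> - b / p <= 0.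
  by move=> b0; rewrite mulNr oppr_le0; apply: mulr_ge0.
have q d : 0 <= d -> d / p ^+ 2 <= 4 * d.
  move=> d0; rewrite ler_pdivrMr; last by rewrite exprn_gt0.
  have : 0 <= d * (4 * p ^+ 2 - 1) by apply: mulr_ge0 => //; nra.
  lra.
rewrite /rate; case: ifP => _.
  have := h 2 ltac:(lra); have := q 0 ltac:(lra); clear; lra.
case: ifP => _.
  have := h (19 / 6) ltac:(lra); have := q (7 / 16) ltac:(lra); clear; lra.
case: ifP => _.
  have := h (dec9 3 471 404 520) ltac:(lra); have := q (1 / 2) ltac:(lra); clear; lra.
case: ifP => _.
  have := h (13 / 3) ltac:(lra); have := q (3 / 4) ltac:(lra); clear; lra.
have := h 2 ltac:(lra); have := q 0 ltac:(lra); clear; lra.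
Qed.

Definition pair_average (R : realType) (m : nat) : R :=
  (rank_cost_sum m.+2)%:R / (m.+2 * m.+1)%:R.

Lemma pair_average_le (R : realType) (c : R) (m k : nat) (x := m.+2%:R : R) (P := 2 ^+ k : R) :
  is_half_sqrt2 c -> (1 < m)%N -> (m.+2 <= 2 ^ k)%N -> (2 ^ k < m.+2.*2)%N ->
  pair_average R m <= 448 / x + 2 * k%:R + rate R c (x / P).
Proof.
move=> hc m1 hi lo; have [cb c2] := hc.
have x0 : 0 < x by rewrite ltr0n.
have P0 : 0 < P by rewrite exprn_gt0.
have [h1 h2 h3 h4 h5] := breakpoints R c hc.
have ie b : b / (x / P) = b * (P / x) by rewrite invf_div.
have ie2 d : d / (x / P) ^+ 2 = d * (P / x) ^+ 2 by rewrite -exprVn invf_div.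
have use := use_2mergeE R m.+2 k hi lo; rewrite -/x -/P in use.
have pos : 0 <= 448 / x by apply: divr_ge0; [clear; lra|exact: ltW].
case: (boolP (use_2merge m.+2)) => um.
  have dbl := pair_average_double R c m k cb c2 m1 um hi lo.
  move: um; rewrite use => /andP[u1 u4].
  rewrite /pair_average; apply: (le_trans dbl).
  rewrite /rate !ie !ie2 ltNge u1 u4 /= -/x -/P.
  have -> : (4 * x <= P * (2 * c + 1)) = (x / P <= b2 c).
    by rewrite ler_pdivrMr // /b2; apply/idP/idP; clear; lra.
  have -> : (2 * x <= P * (1 + c)) = (x / P <= b3 c).
    by rewrite ler_pdivrMr // /b3; apply/idP/idP; clear; lra.
  by rewrite !mulNr.
have sgl := pair_average_single R m k um (ltnW m1) hi lo.
rewrite /pair_average; apply: (le_trans sgl); rewrite -/x -/P.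
suff -> : rate R c (x / P) = 2 + - 2 / (x / P) + 0 / (x / P) ^+ 2.
  by rewrite ie mul0r; move: (P / x) (448 / x) pos; clear => u v v0; lra.
rewrite /rate; case: ifP => // /negbT; rewrite -leNgt => u1.
have u4 : b4 < x / P by rewrite ltNge; move: um; rewrite use u1.
rewrite !leNgt u4 (le_lt_trans h4 u4) (le_lt_trans _ u4) //.
exact: le_trans h3 h4.
Qed.

Lemma passed_mono (R : realType) (c x y : R) : x <= y ->
  (passed R c x <= passed R c y)%N /\
  (passed R c x = passed R c y ->
   [/\ (b1 <= x) = (b1 <= y), (b2 c < x) = (b2 c < y), (b3 c < x) = (b3 c < y) &
       (b4 < x) = (b4 < y)]).
Proof.
move=> xy; rewrite /passed.
have f1 : b1 <= x -> b1 <= y by move=> h; apply: le_trans xy.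
have f2 b : b < x -> b < y by move=> h; apply: lt_le_trans xy.
move: f1 (f2 (b2 c)) (f2 (b3 c)) (f2 b4).
case: (b1 <= x); case: (b1 <= y); case: (b2 c < x); case: (b2 c < y);
  case: (b3 c < x); case: (b3 c < y); case: (b4 < x); case: (b4 < y) => //= h1 h2 h3 h4;
  by [have := h1 isT|have := h2 isT|have := h3 isT|have := h4 isT|split].
Qed.

Lemma acc_step (R : realType) (c x y : R) : is_half_sqrt2 c -> 1 / 2 <= x -> x <= y -> y <= 1 ->
  passed R c x = passed R c y ->
  (y - x) * rate R c y - 20 * (y - x) ^+ 2 <= acc R c y - acc R c x.
Proof.
move=> hc x2 xy y1 /(proj2 (passed_mono R c x y xy))[e1 e2 e3 e4].
have [h1 h2 h3 h4 h5] := breakpoints R c hc.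
rewrite /rate; case: ltP => yb1.
  rewrite (acc1 R c) //; last exact: ltW.
  by apply: prim_step => //; clear; lra.
move: e1; rewrite yb1 => xb1.
case: (leP y (b2 c)) e2 => yb2 e2.
  by rewrite (acc2 R c) //; apply: prim_step => //; clear; lra.
case: (leP y (b3 c)) e3 => yb3 e3.
  by rewrite (acc3 R c x y hc (ltW e2)) //; apply: prim_step => //; clear; lra.
case: (leP y b4) e4 => yb4 e4.
  by rewrite (acc4 R c x y hc (ltW e3)) //; apply: prim_step => //; clear; lra.
by rewrite (acc5 R c x y hc (ltW e4)) //; apply: prim_step => //; clear; lra.
Qed.

(** A pair advances p by 2 / 2^k, whence the factor 2^k / 2. By the geometric series all lower
    octaves together contribute 2^k / 2 times the full integral [acc R c 1]. *)
Definition potential (R : realType) (c : R) (k : nat) (x : R) : R :=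
  k%:R * x - 2 ^+ k + 2 ^+ k / 2 * (acc R c 1 + acc R c (x / 2 ^+ k)).

(* [rate] jumps at breakpoints only; the second term pays for the at most four steps per octave that
   cross one, the last term for the errors O(1 / n) of all other steps. *)
Definition budget (R : realType) (c : R) (k : nat) (x : R) : R :=
  potential R c k x + 200 * (4 * k%:R + (passed R c (x / 2 ^+ k))%:R) + 244 * ln x.

Lemma budget_step (R : realType) (c : R) (m k : nat) : is_half_sqrt2 c ->
  (1 < m)%N -> (m.+2 <= 2 ^ k)%N -> (2 ^ k <= m.*2)%N ->
  pair_average R m <= budget R c k m.+2%:R - budget R c k m%:R.
Proof.
move=> hc m1 hi lo.
have avg := pair_average_le R c m k hc m1 hi ltac:(clear - lo; lia).
set x := m.+2%:R in avg *; set P := 2 ^+ k in avg *; set y := m%:R.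
have xy : x = y + 2 by rewrite /x /y -addn2 natrD.
have y2 : 2 <= y by rewrite /y ler_nat.
have xP : x <= P by rewrite /x /P -natrX ler_nat.
have Py : P <= 2 * y by rewrite /y /P -natrX -natrM ler_nat mul2n.
rewrite /budget /potential -/P.
clearbody x P y.
have P0 : 0 < P by clear - y2 xy xP; lra.
have p2 : 1 / 2 <= y / P by rewrite ler_pdivlMr //; clear - Py; lra.
have pq : y / P <= x / P by rewrite ler_pM2r ?invr_gt0 //; clear - xy; lra.
have p1 : x / P <= 1 by rewrite ler_pdivrMr // mul1r.
have dpq : x / P - y / P = 2 / P by rewrite xy; field; apply: lt0r_neq0.
have dln : 2 / x <= ln x - ln y.
  have := ln_diff_le R x y ltac:(clear - y2 xy; lra) ltac:(clear - y2; lra).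
  have -> : (y - x) / x = - (2 / x) by rewrite xy -mulNr; congr (_ / _); clear; lra.
  clear; lra.
have x0 : 0 < x by clear - y2 xy; lra.
have iPx : P^-1 <= x^-1 by rewrite lef_pV2 ?posrE.
have ix4 : x^-1 <= 1 / 4.
  by rewrite -[x^-1]mul1r ler_pdivrMr //; clear - y2 xy; lra.
have ix0 : 0 <= x^-1 by rewrite invr_ge0 ltW.
have rate7 := rate_le R c (x / P) (le_trans p2 pq).
have [pm pe] := passed_mono R c _ _ pq.
move: pm; rewrite leq_eqVlt => /orP[/eqP e|plt].
  (* No breakpoint is crossed: the errors 448 / x and 40 / P add up to at most 488 / x, which 244
     times the increase of ln x covers. *)
  have := acc_step R c _ _ hc p2 pq p1 e; rewrite dpq => st.
  have stP : rate R c (x / P) - 40 / P <= P / 2 * (acc R c (x / P) - acc R c (y / P)).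
    have -> : rate R c (x / P) - 40 / P = P / 2 * (2 / P * rate R c (x / P) - 20 * (2 / P) ^+ 2).
      by field; apply: lt0r_neq0.
    by apply: ler_wpM2l st; clear - P0; lra.
  rewrite e; clear - avg stP dln iPx ix0 xy; rewrite xy in avg dln iPx ix0 stP *; lra.
(* A breakpoint is crossed: the rate is at most 7 and the potential loses at most 50 against 2 k,
   while the counter releases 200. *)
have lip := acc_lip R c _ _ hc pq; rewrite dpq in lip.
have lipP : - 50 <= P / 2 * (acc R c (x / P) - acc R c (y / P)).
  have -> : - 50 = P / 2 * (- (50 * (2 / P))) by field; apply: lt0r_neq0.
  by apply: ler_wpM2l lip; clear - P0; lra.
have : (passed R c (y / P))%:R + 1 <= (passed R c (x / P))%:R :> R.
  by rewrite natr1 ler_nat.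
clear - avg lipP dln ix4 ix0 xy rate7; rewrite xy in avg lipP dln ix4 ix0 rate7 *; lra.
Qed.

Lemma acc_half (R : realType) (c : R) : is_half_sqrt2 c -> acc R c (1 / 2) = 0.
Proof.
move=> /breakpoints[h1 h2 h3 h4 h5]; rewrite /acc !seg_lo ?addr0 //.
- exact: le_trans h1 (le_trans h2 (le_trans h3 h4)).
- exact: le_trans h1 (le_trans h2 h3).
- exact: le_trans h1 h2.
Qed.

Lemma passed_le4 (R : realType) (c p : R) : (passed R c p <= 4)%N.
Proof.
by rewrite /passed; case: (_ <= _)%R; case: (_ < _)%R; case: (_ < _)%R; case: (_ < _)%R.
Qed.

(** At a power of two the potentials for k and k + 1 coincide, since the integral vanishes at 1/2.
    The counter is reset there, at most by 4, and the growth of 4 k makes up for it. *)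
Lemma budget_next (R : realType) (c : R) (k : nat) : is_half_sqrt2 c ->
  budget R c k (2 ^+ k) <= budget R c k.+1 (2 ^+ k).
Proof.
move=> hc; have P0 : 0 < 2 ^+ k :> R by rewrite exprn_gt0.
rewrite /budget /potential divff ?lt0r_neq0 //.
have -> : 2 ^+ k / 2 ^+ k.+1 = 1 / 2 :> R by rewrite exprS; field; apply: lt0r_neq0.
rewrite acc_half // exprS -[k.+1%:R]natr1.
have : (passed R c 1)%:R <= 4 :> R by rewrite ler_nat passed_le4.
have : 0 <= (passed R c (1 / 2))%:R :> R by rewrite ler0n.
move: (2 ^+ k) (passed R c 1)%:R (passed R c (1 / 2))%:R => P a b; clear; lra.
Qed.

Lemma budget_two (R : realType) (c : R) (k : nat) : is_half_sqrt2 c ->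
  (2 ^ k <= 4)%N -> (2 <= 2 ^ k)%N -> 1 <= budget R c k 2.
Proof.
move=> hc hi lo.
have l20 : 0 <= ln (2 : R) by rewrite ln_ge0 // ler1n.
have hiR : 2 ^+ k <= 4 :> R by rewrite -natrX ler_nat.
have loR : 2 <= 2 ^+ k :> R by rewrite -natrX ler_nat.
have k1 : 1 <= k%:R :> R by rewrite ler1n; case: (k) lo.
rewrite /budget /potential; move: (2 ^+ k) hiR loR => P hiR loR.
have P0 : 0 < P by clear - loR; lra.
have p2 : 1 / 2 <= 2 / P by rewrite ler_pdivlMr //; clear - hiR; lra.
have p1 : 2 / P <= 1 by rewrite ler_pdivrMr // mul1r.
have := acc_lip R c _ _ hc p2; have := acc_lip R c _ _ hc (le_trans p2 p1).
rewrite acc_half //; have := ler0n R (passed R c (2 / P)).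
move=> n0 h1 h2; move: (passed R c (2 / P))%:R (acc R c (2 / P)) (acc R c 1) n0 h1 h2 => n a a1
    n0 h1 h2.
have h3 : -50 <= a1 + a by move: (2 / P) p1 h1 h2 => p; clear; lra.
have h4 : P / 2 * (-50) <= P / 2 * (a1 + a) by apply: ler_wpM2l h3; clear - P0; lra.
clear - h4 hiR k1 n0 l20; lra.
Qed.

Lemma complexity_le_budget (R : realType) (c : R) (j k : nat) : is_half_sqrt2 c -> (0 < j)%N ->
  (j.*2 <= 2 ^ k)%N -> (2 ^ k <= j.*2.*2)%N ->
  ins12_complexity R j.*2 <= budget R c k j.*2%:R.
Proof.
move=> hc; case: j => // j _; elim: j k => [|j IH] k hi lo.
  rewrite ins12_complexityE // big_geq // addr0; exact: budget_two.
have cE : ins12_complexity R j.+2.*2 = ins12_complexity R j.+1.*2 + pair_average R j.+1.*2.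
  by rewrite !ins12_complexityE // [in LHS]big_nat_recr //= addrA.
have step k' : (j.+2.*2 <= 2 ^ k')%N -> (2 ^ k' <= j.+1.*2.*2)%N ->
    ins12_complexity R j.+2.*2 <= budget R c k' j.+2.*2%:R.
  move=> hi' lo'; rewrite cE.
  have := IH k' ltac:(clear - hi'; lia) lo'.
  have := budget_step R c j.+1.*2 k' hc ltac:(clear; lia) hi' lo'.
  rewrite -doubleS; clear; lra.
case: (leqP (2 ^ k) j.+1.*2.*2) => [lo'|lo']; first exact: step.
(* The number of elements is now exactly the left end of the octave, so the step is accounted for in
   the octave below and the budget is then transferred. *)
case: k hi lo lo' => [|[|k]] hi lo lo'; [clear - hi; lia|clear - hi; lia|].
have e : (2 ^ k.+1 = j.+2.*2)%N by move: hi lo lo'; rewrite !expnS; clear; lia.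
have := budget_next R c k.+1 hc; rewrite -natrX e; apply: le_trans.
by apply: step; rewrite e //; clear; lia.
Qed.

(** * The numerical inequality *)

(** The cubic Bernstein basis on [l, r]: a cubic with nonnegative coefficients in it is nonnegative
    on the interval, which turns the cubic inequalities below into linear arithmetic. *)
Lemma bernstein3 (R : realType) (l r p : R) : l <= p -> p <= r ->
  [/\ 0 <= (p - l) ^+ 3, 0 <= (p - l) ^+ 2 * (r - p), 0 <= (p - l) * (r - p) ^+ 2 &
      0 <= (r - p) ^+ 3].
Proof.
move=> lp pr; have h1 : 0 <= p - l by lra. have h2 : 0 <= r - p by lra.
by split; rewrite ?mulr_ge0 ?exprn_ge0.
Qed.

(* The tangent of ln at [q] turns monotonicity of the primitive into a cubic inequality. *)
Lemma slope_pos (R : realType) (a b d k p q L : R) : 0 < p -> 0 < q -> ln q <= L -> 0 <= L + p /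
    q ->
  (L + p / q) * p ^+ 2 <= 693 / 1000 * ((a / 2 + k) * p ^+ 2 + b / 2 * p + d / 2) ->
  0 <= ln 2 * (a / 2 + k) + ln 2 * (b / 2) / p + - 1 * (ln p + 1) - - (ln 2 * (d / 2)) / p ^+ 2.
Proof.
move=> p0 q0 lq L0 cub; have l2 : 693 / 1000 <= ln 2 :> R by have /andP[l2 _] := ln2_bounds R; clear - l2; lra.
have lnp : ln p + 1 <= L + p / q.
  have := ln_diff_le R q p q0 p0.
  have -> : (p - q) / q = p / q - 1 by field; apply: lt0r_neq0.
  by clear - lq; lra.
set K := a / 2 + k + b / 2 / p + d / 2 / p ^+ 2.
have KE : (a / 2 + k) * p ^+ 2 + b / 2 * p + d / 2 = K * p ^+ 2.
  by rewrite /K; field; apply: lt0r_neq0.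
have e : ln 2 * (a / 2 + k) + ln 2 * (b / 2) / p + - 1 * (ln p + 1) - - (ln 2 * (d / 2)) / p ^+ 2
    = ln 2 * K - (ln p + 1) by rewrite /K; field; apply: lt0r_neq0.
rewrite e; rewrite KE [_ * (K * _)]mulrA ler_pM2r ?exprn_gt0 // in cub.
clearbody K; have K0 : 0 <= K by clear - cub L0; lra.
have := ler_wpM2r K0 l2; clear - lnp cub; lra.
Qed.

Definition kap {R : realType} : R := dec9 1 401 180 0.

Lemma prim_entropy_mono (R : realType) (a b d l r x y : R) : 0 < l -> l <= x -> x <= y -> y <= r ->
  (forall p, l <= p <= r -> 0 <= ln 2 * (a / 2 + kap) + ln 2 * (b / 2) / p + - 1 * (ln p + 1)
     - - (ln 2 * (d / 2)) / p ^+ 2) ->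
  (y * ln y - ln 2 * kap * y) - (x * ln x - ln 2 * kap * x) <=
  ln 2 / 2 * (prim R a b d y - prim R a b d x).
Proof.
move=> l0 lx xy yr /(entropy_nondecr R _ _ _ _ l r x y l0 lx xy yr); rewrite /prim.
clear; lra.
Qed.

Lemma slope2 (R : realType) (c p : R) : is_half_sqrt2 c -> b1 <= p <= b2 c ->
  0 <= ln 2 * (dec9 2 676 479 90 / 2 + kap) + ln 2 * (- (19 / 6) / 2) / p + - 1 * (ln p + 1)
     - - (ln 2 * (7 / 16 / 2)) / p ^+ 2.
Proof.
move=> [/andP[c1 c2] _]; rewrite /b1 /b2 => /andP[p1 p2].
have [t1 t2 t3 [t4 t5 t6]] := ln_tangents R.
have {c1 c2}p2 : p <= dec9 0 603 560 0 by clear - c2 p2; lra.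
have [q1 q2 q3 q4] := bernstein3 R _ _ p p1 p2.
apply: (slope_pos R _ _ _ _ p (58 / 100) _ _ _ t1); rewrite ?/kap; clear - p1 p2 q1 q2 q3 q4; lra.
Qed.

Lemma slope3 (R : realType) (c p : R) : is_half_sqrt2 c -> b2 c <= p <= b3 c ->
  0 <= ln 2 * (dec9 3 9 812 420 / 2 + kap) + ln 2 * (- (dec9 3 471 404 520) / 2) / p + - 1 * (ln
      p + 1)
     - - (ln 2 * (1 / 2 / 2)) / p ^+ 2.
Proof.
move=> [/andP[c1 c2] _]; rewrite /b2 /b3 => /andP[p1 p2].
have [t1 t2 t3 [t4 t5 t6]] := ln_tangents R.
have {p2}p2 : p <= dec9 0 853 560 0 by clear - c2 p2; lra.
have {c1 c2 p1}p1 : dec9 0 603 550 0 <= p by clear - c1 p1; lra.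
(* The slope is close to zero on this piece, about 0.006 at p = 0.7, so each tangent is used only
   near its point of contact. *)
case: (lerP p (67 / 100)) => [m1|/ltW m1].
  have [q1 q2 q3 q4] := bernstein3 R _ _ p p1 m1.
  apply: (slope_pos R _ _ _ _ p (63 / 100) _ _ _ t2); rewrite ?/kap; clear - p1 m1 q1 q2 q3 q4; lra.
case: (lerP p (76 / 100)) => [m2|/ltW m2].
  have [q1 q2 q3 q4] := bernstein3 R _ _ p m1 m2.
  apply: (slope_pos R _ _ _ _ p (71 / 100) _ _ _ t3); rewrite ?/kap; clear - m1 m2 q1 q2 q3 q4; lra.
case: (lerP p (83 / 100)) => [m3|/ltW m3].
  have [q1 q2 q3 q4] := bernstein3 R _ _ p m2 m3.
  apply: (slope_pos R _ _ _ _ p (79 / 100) _ _ _ t4); rewrite ?/kap; clear - m2 m3 q1 q2 q3 q4; lra.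
have [q1 q2 q3 q4] := bernstein3 R _ _ p m3 p2.
apply: (slope_pos R _ _ _ _ p (845 / 1000) _ _ _ t5); rewrite ?/kap; clear - m3 p2 q1 q2 q3 q4; lra.
Qed.

Lemma slope4 (R : realType) (c p : R) : is_half_sqrt2 c -> b3 c <= p <= b4 ->
  0 <= ln 2 * (dec9 3 676 479 90 / 2 + kap) + ln 2 * (- (13 / 3) / 2) / p + - 1 * (ln p + 1)
     - - (ln 2 * (3 / 4 / 2)) / p ^+ 2.
Proof.
move=> [/andP[c1 c2] _]; rewrite /b3 /b4 => /andP[p1 p2].
have [t1 t2 t3 [t4 t5 t6]] := ln_tangents R.
have {c1 c2 p1}p1 : dec9 0 853 550 0 <= p by clear - c1 p1; lra.
have [q1 q2 q3 q4] := bernstein3 R _ _ p p1 p2.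
apply: (slope_pos R _ _ _ _ p (87 / 100) _ _ _ t6); rewrite ?/kap; clear - p1 p2 q1 q2 q3 q4; lra.
Qed.

(** Over the whole range of 2Merge the slack of the final inequality is smallest at [b4], which
    leaves only the two ranges of single insertions to be examined. *)
Lemma acc_mid_mono (R : realType) (c p : R) : is_half_sqrt2 c -> b1 <= p -> p <= b4 ->
  (b4 * ln b4 - ln 2 * kap * b4) - (p * ln p - ln 2 * kap * p) <=
  ln 2 / 2 * (acc R c b4 - acc R c p).
Proof.
move=> hc p1 p4; have [h1 h2 h3 h4 h5] := breakpoints R c hc.
have b10 : 0 < b1 :> R by apply: lt_le_trans h1; clear; lra.
have b20 : 0 < b2 c by apply: lt_le_trans h2.
have b30 : 0 < b3 c by apply: lt_le_trans h3.
have m2 x y : b1 <= x -> x <= y -> y <= b2 c ->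
    (y * ln y - ln 2 * kap * y) - (x * ln x - ln 2 * kap * x) <= ln 2 / 2 * (acc R c y - acc R c x).
  move=> bx xy yb; rewrite (acc2 R c) //.
  by apply: (prim_entropy_mono R _ _ _ b1 (b2 c)) => // z; apply: slope2.
have m3 x y : b2 c <= x -> x <= y -> y <= b3 c ->
    (y * ln y - ln 2 * kap * y) - (x * ln x - ln 2 * kap * x) <= ln 2 / 2 * (acc R c y - acc R c x).
  move=> bx xy yb; rewrite (acc3 R c) //.
  by apply: (prim_entropy_mono R _ _ _ (b2 c) (b3 c)) => // z; apply: slope3.
have m4 x y : b3 c <= x -> x <= y -> y <= b4 ->
    (y * ln y - ln 2 * kap * y) - (x * ln x - ln 2 * kap * x) <= ln 2 / 2 * (acc R c y - acc R c x).
  move=> bx xy yb; rewrite (acc4 R c) //.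
  by apply: (prim_entropy_mono R _ _ _ (b3 c) b4) => // z; apply: slope4.
have c4 := m4 _ _ (lexx _) h4 (lexx _).
have c3 := m3 _ _ (lexx _) h3 (lexx _).
case: (lerP p (b2 c)) => [pb2|/ltW pb2].
  have := m2 _ _ p1 pb2 (lexx _); clear - c3 c4; lra.
case: (lerP p (b3 c)) => [pb3|/ltW pb3].
  have := m3 _ _ pb2 pb3 (lexx _); clear - c4; lra.
exact: m4.
Qed.

Lemma inv_le_dec (R : realType) (x v : R) : 0 < x -> 1 <= v * x -> x^-1 <= v.
Proof. by move=> x0 h; rewrite -[x^-1]mul1r ler_pdivrMr. Qed.

Lemma inv_ge_dec (R : realType) (x v : R) : 0 < x -> v * x <= 1 -> v <= x^-1.
Proof. by move=> x0 h; rewrite -[x^-1]mul1r ler_pdivlMr. Qed.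

Lemma acc_one_le (R : realType) (c : R) : is_half_sqrt2 c -> acc R c 1 <= - dec9 0 403 226 150.
Proof.
move=> hc; have [h1 h2 h3 h4 h5] := breakpoints R c hc.
have [/andP[c1 c2] _] := hc.
have s1 := acc1 R c _ _ hc (lexx _) h1 (lexx _).
have s2 := acc2 R c _ _ hc (lexx _) h2 (lexx _).
have s3 := acc3 R c _ _ hc (lexx _) h3 (lexx _).
have s4 := acc4 R c _ _ hc (lexx _) h4 (lexx _).
have s5 := acc5 R c _ _ hc (lexx _) h5 (lexx _).
have s0 := acc_half R c hc.
have /andP[l2 _] := ln2_bounds R.
have b10 : 0 < b1 :> R by apply: lt_le_trans h1; clear; lra.
have b20 : 0 < b2 c by apply: lt_le_trans h2.
have b30 : 0 < b3 c by apply: lt_le_trans h3.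
have b40 : 0 < b4 :> R by apply: lt_le_trans h4.
(* The direction of each bound on a logarithm or an inverse is dictated by the sign of the jump of
   the corresponding coefficient at that breakpoint. *)
have lb1 : ln (b1 : R) + ln 2 <= dec9 0 97 308 183 := ln_b1 R.
have lb2 := ln_b2 R (b2 c) b20 ltac:(rewrite /b2; clear - c2; lra).
have lb3 := ln_b3 R (b3 c) b30 ltac:(rewrite /b3; clear - c2; lra).
have lb4 : - dec9 0 118 783 537 <= ln (b4 : R) := ln_b4 R.
have lh : ln (1 / 2 : R) = - ln 2 by rewrite mul1r lnV // posrE; clear; lra.
have i1 := inv_le_dec R b1 (dec9 1 814 552 713) b10 ltac:(rewrite /b1; clear; lra).
have i2 := inv_le_dec R (b2 c) (dec9 1 656 854 250) b20 ltac:(rewrite /b2; clear - c1; lra).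
have i3 := inv_le_dec R (b3 c) (dec9 1 171 572 876) b30 ltac:(rewrite /b3; clear - c1; lra).
have i4 := inv_ge_dec R b4 (dec9 1 126 126 126) b40 ltac:(rewrite /b4; clear; lra).
have eb1 : b1 = dec9 0 551 100 0 :> R by [].
have eb4 : b4 = dec9 0 888 0 0 :> R by [].
have gb2 : dec9 0 603 553 390 + 1 / (2 * 10 ^+ 9) <= b2 c by rewrite /b2; clear - c1; lra.
have gb3 : dec9 0 853 553 390 + 1 / (2 * 10 ^+ 9) <= b3 c by rewrite /b3; clear - c1; lra.
have -> : acc R c 1 = (prim R 2 (- 2) 0 b1 - prim R 2 (- 2) 0 (1 / 2))
   + (prim R (dec9 2 676 479 90) (- (19 / 6)) (7 / 16) (b2 c) - prim R (dec9 2 676 479 90) (- (19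
       / 6)) (7 / 16) b1)
   + (prim R (dec9 3 9 812 420) (- (dec9 3 471 404 520)) (1 / 2) (b3 c)
      - prim R (dec9 3 9 812 420) (- (dec9 3 471 404 520)) (1 / 2) (b2 c))
   + (prim R (dec9 3 676 479 90) (- (13 / 3)) (3 / 4) b4 - prim R (dec9 3 676 479 90) (- (13 /
       3)) (3 / 4) (b3 c))
   + (prim R 2 (- 2) 0 1 - prim R 2 (- 2) 0 b4).
  by rewrite -s1 -s2 -s3 -s4 -s5 s0; clear; lra.
rewrite /prim lh ln1 !mul0r.
move: (ln (b1 : R)) (ln (b2 c)) (ln (b3 c)) (ln (b4 : R)) (ln (2 : R)) ((b1 : R)^-1) ((b2 c)^-1)
    ((b3 c)^-1) ((b4 : R)^-1)
   lb1 lb2 lb3 lb4 l2 i1 i2 i3 i4.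
move: (b2 c) (b3 c) gb2 gb3; rewrite eb1 eb4; clear => *; lra.
Qed.

(* The margin is about 2.4e-7; the difference of the two sides is convex with minimum near
   p = 0.898305. *)
Lemma acc_high (R : realType) (c p : R) : is_half_sqrt2 c -> b4 <= p -> p <= 1 ->
  ln 2 * ((acc R c 1 + acc R c p) / 2) <= ln 2 * (1 - kap * p) + p * ln p.
Proof.
move=> hc p4 p1; have J := acc_one_le R c hc.
have s5 := acc5 R c _ _ hc p4 p1 (lexx _); rewrite /prim ln1 !mul0r in s5.
have b4E : b4 = dec9 0 888 0 0 :> R by [].
have p0 : 0 < p by apply: lt_le_trans p4; rewrite b4E; clear; lra.
have /andP[l2 l2'] := ln2_bounds R.
have /andP[lq lq'] := ln_p0 R.
set q := dec9 0 898 305 0 in lq lq'.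
have q0 : 0 < q by rewrite /q; clear; lra.
have iq := inv_le_dec R q (dec9 1 113 207 653) q0 ltac:(rewrite /q; clear; lra).
have iq' := inv_ge_dec R q (dec9 1 113 207 652) q0 ltac:(rewrite /q; clear; lra).
pose k1 : R := - (ln 2 * (1 + kap)).
have slope_q : - (1 / 10 ^+ 7) <= k1 + ln 2 / q + 1 * (ln q + 1) - 0 / q ^+ 2 <= 1 / 10 ^+ 7.
  have h1 : 0 <= (ln 2 - dec9 0 693 147 178) * (1 + kap - q^-1) by apply: mulr_ge0; rewrite /kap;
      clear - l2 iq; lra.
  have h2 : 0 <= (dec9 0 693 147 182 - ln 2) * (1 + kap - q^-1) by apply: mulr_ge0; rewrite /kap;
      clear - l2' iq; lra.
  rewrite /k1 mul0r; move: (q^-1) (ln q) iq iq' lq lq' h1 h2 => i l; rewrite /kap.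
  by move: (ln 2) => L; clear => *; apply/andP; split; lra.
(* The second derivative 1 / x - ln 2 / x^2 is nonnegative for x >= ln 2, which gives the
   convexity. *)
have diff x y : 0 < x -> x <= y -> ln 2 <= x ->
   k1 + ln 2 / x + 1 * (ln x + 1) - 0 / x ^+ 2 <= k1 + ln 2 / y + 1 * (ln y + 1) - 0 / y ^+ 2.
  move=> x0 xy lx; have y0 : 0 < y by apply: lt_le_trans xy.
  have := ln_diff_le R y x y0 x0; rewrite !mul0r.
  have e : ln 2 / x - ln 2 / y = ln 2 * ((y - x) / (x * y)) by field; rewrite !lt0r_neq0.
  have e2 : (x - y) / y = - (x * ((y - x) / (x * y))) by field; rewrite !lt0r_neq0.
  have pos : 0 <= (y - x) / (x * y) by apply: divr_ge0; [rewrite subr_ge0|apply: mulr_ge0; apply: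
      ltW].
  have := ler_wpM2r pos lx; rewrite e2; clear - e; lra.
pose f := fun x : R => (k1 * x + ln 2 * ln x + 1 * (x * ln x) + 0 / x).
have lamq : ln 2 <= q by rewrite /q; clear - l2'; lra.
have lamb : ln 2 <= b4 :> R by rewrite b4E; clear - l2'; lra.
have fq : - (2 * ln 2) + ln 2 * acc R c 1 + 1 / (5 * 10 ^+ 6) <= f q.
  have h1 : 0 <= ln 2 * (- dec9 0 403 226 150 - acc R c 1) by apply: mulr_ge0; clear - l2 J; lra.
  have h2 : 0 <= ln 2 * (ln q + dec9 0 107 245 626) by apply: mulr_ge0; clear - l2 lq; lra.
  have l20 : 0 <= ln 2 - dec9 0 693 147 178 :> R by clear - l2; lra.
  rewrite /f /k1 mul0r /kap; rewrite /q in h2 lq *; move: (ln (dec9 0 898 305 0)) (ln 2) (acc R c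
      1) h1 h2 lq l20.
  by clear => *; lra.
(* The derivative at q is at most 10^(-7) in absolute value, not zero; by convexity this loses at
   most 10^(-7) over a distance below 1, half of the 2 * 10^(-7) secured at q. *)
have fp : f q - 1 / 10 ^+ 7 <= f p.
  move: slope_q => /andP[sq sq'].
  case: (lerP q p) => [qp|/ltW pq].
    have pos z : q <= z <= 1 -> 0 <= k1 + 1 / 10 ^+ 7 + ln 2 / z + 1 * (ln z + 1) - 0 / z ^+ 2.
      by move=> /andP[qz _]; have := diff q z q0 qz lamq; clear - sq; lra.
    have := entropy_nondecr R (k1 + 1 / 10 ^+ 7) (ln 2) 1 0 q 1 q p q0 (lexx _) qp p1 pos.
    rewrite /f; clearbody q; clear - p1 q0 qp; lra.
  have pos z : b4 <= z <= q -> 0 <= - k1 + 1 / 10 ^+ 7 + - ln 2 / z + - 1 * (ln z + 1) - 0 / z ^+ 2.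
    move=> /andP[bz zq]; have z0 : 0 < z by apply: lt_le_trans bz; rewrite b4E; clear; lra.
    have := diff z q z0 zq (le_trans lamb bz); rewrite !mul0r in sq' *; rewrite mulNr; clear -
        sq'; lra.
  have b40 : 0 < b4 :> R by rewrite b4E; clear; lra.
  have q1 : q <= 1 by rewrite /q; clear; lra.
  have := entropy_nondecr R (- k1 + 1 / 10 ^+ 7) (- ln 2) (- 1) 0 b4 q p q b40 p4 pq (lexx _) pos.
  rewrite /f; clearbody q; clear - p0 q1 pq; lra.
have e : acc R c p = acc R c 1 - (2 - 2 * p + 2 * ln p) by clear - s5; lra.
rewrite e; move: fp fq; rewrite /f /k1 !mul0r; clear - l2; lra.
Qed.

Lemma acc_low (R : realType) (c p : R) : is_half_sqrt2 c -> 1 / 2 <= p -> p <= b1 ->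
  ln 2 * ((acc R c 1 + acc R c p) / 2) <= ln 2 * (1 - kap * p) + p * ln p.
Proof.
move=> hc p2 pb; have J := acc_one_le R c hc.
have s1 := acc1 R c _ _ hc (lexx _) p2 pb; rewrite /prim acc_half // !mul0r !subr0 in s1.
have b1E : b1 = dec9 0 551 100 0 :> R by [].
have p0 : 0 < p by clear - p2; lra.
have lh : ln (1 / 2 : R) = - ln 2 by rewrite mul1r lnV // posrE; clear; lra.
have /andP[l2 l2'] := ln2_bounds R.
(* With 2 p = (1 + t) / (1 - t) the first term of the series gives ln (2 p) >= 2 t, and the claim
   becomes a quadratic inequality in t. *)
pose t := (2 * p - 1) / (2 * p + 1).
have pt : 2 * p * (1 - t) = 1 + t by rewrite /t; field; clear - p2; lra.
have t0 : 0 <= t by rewrite /t; apply: divr_ge0; clear - p2; lra.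
have t1 : t <= 1 / 20 by rewrite /t ler_pdivrMr; rewrite b1E in pb; clear - p2 pb; lra.
have lnt : 2 * t <= ln (2 * p).
  apply: (ln_lower R t); first by apply/andP; split; clear - t0 t1; lra.
    by rewrite pt.
  have h n : 0 <= t ^+ n by apply: exprn_ge0.
  by have := h 3%N; have := h 5%N; have := h 7%N; clear; lra.
rewrite lnM ?posrE // in lnt.
rewrite s1 lh.
have e : acc R c 1 = - (dec9 0 403 226 150 + (- dec9 0 403 226 150 - acc R c 1)) by clear; lra.
set g := - dec9 0 403 226 150 - acc R c 1 in e.
have g0 : 0 <= g by rewrite /g; clear - J; lra.
rewrite e; clearbody g t.
suff : 0 <= ln 2 * (3 / 2 + dec9 0 403 226 150 / 2 - (2 + kap) * p) + (ln 2 + p) * (2 * t).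
  have h1 : 0 <= (ln 2 + p) * (ln 2 + ln p - 2 * t) by apply: mulr_ge0; clear - l2 p0 lnt; lra.
  have h2 : 0 <= ln 2 * g by apply: mulr_ge0 => //; clear - l2; lra.
  clear - h1 h2; rewrite /kap; lra.
have d0 : 0 < 2 * (1 - t) by clear - t1; lra.
rewrite -(pmulr_rge0 _ d0).
have -> : 2 * (1 - t) * (ln 2 * (3 / 2 + dec9 0 403 226 150 / 2 - (2 + kap) * p) + (ln 2 + p) *
    (2 * t))
  = ln 2 * ((3 + dec9 0 403 226 150) * (1 - t) - (2 + kap) * (1 + t)) + (2 * ln 2 * (1 - t) + (1
      + t)) * (2 * t).
  by rewrite -pt; clear; lra.
have h1 : 0 <= (dec9 0 693 147 182 - ln 2) * t by apply: mulr_ge0; clear - l2' t0; lra.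
have h2 : 0 <= (dec9 0 693 147 182 - ln 2) * t ^+ 2 by apply: mulr_ge0; [clear - l2'; lra|apply:
    exprn_ge0].
have h3 : 0 <= t * (1 / 20 - t) by apply: mulr_ge0; clear - t0 t1; lra.
have h4 : 0 <= ln 2 - dec9 0 693 147 178 :> R by clear - l2; lra.
rewrite /kap; move: (ln 2) h1 h2 h3 h4 t0 => L; clear => *; lra.
Qed.

Lemma acc_le (R : realType) (c p : R) : is_half_sqrt2 c -> 1 / 2 <= p -> p <= 1 ->
  (acc R c 1 + acc R c p) / 2 <= 1 - kap * p + p * (ln p / ln 2).
Proof.
move=> hc p2 p1; have /andP[l2 _] := ln2_bounds R.
have l0 : 0 < ln (2 : R) by clear - l2; lra.
rewrite -(ler_pM2l l0) mulrDr.
have -> : ln 2 * (p * (ln p / ln 2)) = p * ln p by field; apply: lt0r_neq0.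
have [h1 h2 h3 h4 h5] := breakpoints R c hc.
case: (lerP p b1) => [pb|/ltW pb]; first exact: acc_low.
case: (lerP b4 p) => [pb4|/ltW pb4]; first exact: acc_high.
have := acc_mid_mono R c p hc pb pb4.
have := acc_high R c b4 hc (lexx _) h5.
clear; lra.
Qed.

Lemma half_sqrt2_exists (R : realType) : exists c : R, is_half_sqrt2 c.
Proof.
exists (Num.sqrt (1 / 2)); have s2 : Num.sqrt (1 / 2) ^+ 2 = 1 / 2 :> R.
  by rewrite sqr_sqrtr //; lra.
have s0 : 0 <= Num.sqrt (1 / 2 : R) by apply: sqrtr_ge0.
split=> //; move: (Num.sqrt (1 / 2)) s2 s0 => s s2 s0; clear - s2 s0.
by apply/andP; split; rewrite ltNge; apply/negP => h; nra.
Qed.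

Theorem theorem1 (R : realType) :
  exists C : R, forall n : nat, ~~ odd n -> (2 <= n)%N ->
    ins12_complexity R n <=
      n%:R * lg (n%:R : R) - (140118%:R / 100000%:R) * n%:R + C * lg (n%:R : R).
Proof.
have [c hc] := half_sqrt2_exists R.
(* The overhead of the budget is at most 800 k + 800 + 244 ln n. By k <= lg n + 1 and lg n >= 1 this
   is at most 2644 lg n. *)
exists 4000 => n ev n2.
have [j nE] : exists j, n = j.*2 by exists n./2; rewrite -[LHS]odd_double_half (negbTE ev).
have j0 : (0 < j)%N by lia.
have [lo hi] := up_log_le_itv n ltac:(lia).
have := complexity_le_budget R c j (up_log 2 n) hc j0; rewrite -nE => /(_ hi ltac:(clear - lo;
    lia)).
move: (up_log 2 n) lo hi => k lo hi.
have hiR : n%:R <= 2 ^+ k :> R by rewrite -natrX ler_nat.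
have loR : 2 ^+ k <= 2 * n%:R :> R by rewrite -natrX -natrM ler_nat mul2n ltnW.
have x2 : 2 <= n%:R :> R by rewrite ler_nat.
have /andP[l2 l2'] := ln2_bounds R.
have l0 : 0 < ln (2 : R) by clear - l2; lra.
rewrite /budget /potential /lg.
have P0 : 0 < 2 ^+ k :> R by rewrite exprn_gt0.
have lP : ln (2 ^+ k) = k%:R * ln 2 :> R by rewrite lnXn; [rewrite mulr_natl|clear; lra].
have := passed_le4 R c (n%:R / 2 ^+ k); rewrite -(ler_nat R).
move: (passed R c _)%:R => d d4.
move: n%:R (2 ^+ k) hiR loR x2 P0 lP d4 => x P hiR loR x2 P0 lP d4.
have x0 : 0 < x by clear - x2; lra.
have p2 : 1 / 2 <= x / P by rewrite ler_pdivlMr //; clear - loR; lra.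
have p1 : x / P <= 1 by rewrite ler_pdivrMr // mul1r.
have := acc_le R c _ hc p2 p1; rewrite ln_div ?posrE // lP.
move: (acc R c 1) (acc R c (x / P)) => a1 a acc_h budget_h.
have h1 : P * ((a1 + a) / 2) <= P * (1 - kap * (x / P) + x / P * ((ln x - k%:R * ln 2) / ln 2)).
  by apply: ler_wpM2l acc_h; apply: ltW.
(* Scaled by 2^k, the numerical inequality cancels the terms k x - 2^k of the potential exactly. *)
have e : P * (1 - kap * (x / P) + x / P * ((ln x - k%:R * ln 2) / ln 2)) =
    P - kap * x + x * (ln x / ln 2) - k%:R * x by field; rewrite !lt0r_neq0.
rewrite {}e in h1.
have lnE : ln x = ln x / ln 2 * ln 2 by field; apply: lt0r_neq0.
have lx : ln (2 : R) <= ln x by rewrite ler_ln ?posrE.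
have lg1 : 1 <= ln x / ln 2 by rewrite ler_pdivlMr // mul1r.
have kl : k%:R <= ln x / ln 2 + 1.
  have : ln P <= ln (2 * x) by rewrite ler_ln ?posrE //; apply: mulr_gt0.
  rewrite lP lnM ?posrE // => h.
  by rewrite -(ler_pM2r l0) mulrDl mul1r divfK ?lt0r_neq0 // addrC.
have lnle : ln x <= ln x / ln 2.
  by rewrite ler_pdivlMr // ler_piMr // ?(le_trans _ lx) ?ltW //; clear - l2'; lra.
have kapE : 140118%:R / 100000%:R = kap :> R by rewrite /kap; clear; lra.
rewrite kapE; move: (ln x / ln 2) lg1 kl lnle h1 => g g1 kl lnle h1.
clear - budget_h h1 d4 g1 kl lnle; lra.
Qed.
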